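(* Consider the uplink of a cell-free XL-MIMO system with $M$ base stations (BSs), each with $N_r$ antennas, and $K$ user equipments (UEs), each with $N_s$ antennas, where the channel matrices $\mathbf{H}_{mk}\in\mathbb{C}^{N_r\times N_s}$, the data vectors, the noise, the estimates $\check{\mathbf{x}}_{mk}$ and $\hat{\mathbf{x}}_k$, and the matrices $\mathbf{Z}_{mk}$ and $\mathbf{T}_{mkm'l}$ are as described in the context. Suppose every BS uses maximum ratio (MR) combining, $\mathbf{V}_{mk}=\mathbf{H}_{mk}$ for all $m,k$. Define $$\mathbf{E}_{k,(1)}=\sqrt{p}\sum_{m=1}^M \mathbf{Z}_{mk},\qquad \boldsymbol{\Psi}_{k,(1)}=p\sum_{l=1}^K\sum_{m=1}^M\sum_{m'=1}^M \mathbf{T}_{mkm'l}-\mathbf{E}_{k,(1)}\mathbf{E}_{k,(1)}^H+\sigma_w^2\sum_{m=1}^M\mathbf{Z}_{mk},$$ and assume $\boldsymbol{\Psi}_{k,(1)}$ is invertible. Then an achievable spectral efficiency for UE $k$ in the cell-free XL-MIMO is $$\mathrm{SE}_k^{(1)}=\log_2\left|\mathbf{I}_{N_s}+\mathbf{E}_{k,(1)}^H\boldsymbol{\Psi}_{k,(1)}^{-1}\mathbf{E}_{k,(1)}\right|.$$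
   Context: System model. BS $m$ ($m=1,\dots,M$) has $N_r$ antennas and UE $k$ ($k=1,\dots,K$) has $N_s$ antennas. The channel from UE $k$ to BS $m$ is $\mathbf{H}_{mk}=\mathbf{U}_r^{(m)}\big(\boldsymbol{\Sigma}^{(mk)}\odot\mathbf{W}^{(mk)}\big)(\mathbf{U}_s^{(k)})^H$, where $\mathbf{U}_r^{(m)}\in\mathbb{C}^{N_r\times n_r}$, $\mathbf{U}_s^{(k)}\in\mathbb{C}^{N_s\times n_s}$ and $\boldsymbol{\Sigma}^{(mk)}\in\mathbb{R}^{n_r\times n_s}$ are deterministic, $\odot$ is the entrywise product, and $\mathbf{W}^{(mk)}$ has i.i.d. $\mathcal{CN}(0,1)$ entries, with the $\mathbf{W}^{(mk)}$ independent across all pairs $(m,k)$; thus $\mathrm{vec}(\mathbf{H}_{mk})\sim\mathcal{CN}(\mathbf{0},\mathbf{R}_{mk})$ for some covariance $\mathbf{R}_{mk}$, independently over $(m,k)$. UE $k$ transmits data $\mathbf{x}_k\sim\mathcal{CN}(\mathbf{0},\mathbf{I}_{N_s})$ with power $p$, the $\mathbf{x}_k$ being mutually independent and independent of the channels and noise. BS $m$ receives $\mathbf{y}_m=\sqrt{p}\sum_{k=1}^K\mathbf{H}_{mk}\mathbf{x}_k+\mathbf{n}_m$, where $\mathbf{n}_m\sim\mathcal{CN}(\mathbf{0},\sigma_w^2\mathbf{I}_{N_r})$ are independent of each other and of everything else. With combining matrices $\mathbf{V}_{mk}\in\mathbb{C}^{N_r\times N_s}$, BS $m$ forms the local estimate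 $\check{\mathbf{x}}_{mk}=\mathbf{V}_{mk}^H\mathbf{y}_m$ and sends it to a central processing unit, which forms $\hat{\mathbf{x}}_k=\frac1M\sum_{m=1}^M\check{\mathbf{x}}_{mk}$. ''Achievable spectral efficiency'' means a lower bound (in bit/s/Hz) on the mutual information $I(\mathbf{x}_k;\hat{\mathbf{x}}_k)$. Notation: $\mathbf{Z}_{mk}=\mathbb{E}\{\mathbf{H}_{mk}^H\mathbf{H}_{mk}\}\in\mathbb{C}^{N_s\times N_s}$ and $\mathbf{T}_{mkm'l}=\mathbb{E}\{\mathbf{H}_{mk}^H\mathbf{H}_{ml}\mathbf{H}_{m'l}^H\mathbf{H}_{m'k}\}\in\mathbb{C}^{N_s\times N_s}$; $|\cdot|$ denotes the determinant. *)

(* Defs.v *)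
From HB Require Import structures.
From mathcomp Require Import all_boot all_order all_algebra.
From mathcomp Require Import all_classical all_reals all_analysis.
From mathcomp Require Import complex.
Set Implicit Arguments. Unset Strict Implicit. Unset Printing Implicit Defensive.
Import Order.TTheory GRing.Theory Num.Theory.
Local Open Scope classical_set_scope.
Local Open Scope ring_scope.

Section Defs.
Context {R : realType} {d : measure_display} {Omega : measurableType d}.
Variable P : probability Omega R.
Local Notation C := R[i].

(* Probability / information-theoretic notions                              *)

(** sigma-algebra on Omega generated by a finite family of real random
    variables (e.g. the real and imaginary parts of all entries of a complex
    random vector); this is sigma(X) for the random vector X. *)
Definition gen_sigma (I : finType) (X : I -> Omega -> R) : set (set Omega) :=
  <<s [set A | exists i B, measurable B /\ A = X i @^-1` B] >>.

(** mutual independence of a finite family of real random variables *)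
Definition mutually_independent (I : finType) (X : I -> Omega -> R) : Prop :=
  forall (J : {set I}) (B : I -> set R), (forall i, measurable (B i)) ->
    P (\bigcap_(i in [set j | j \in J]) (X i @^-1` B i)) =
    (\prod_(i in J) P (X i @^-1` B i))%E.

(** finite measurable partitions of Omega with blocks in F *)
Definition is_partition (F : set (set Omega)) (n : nat) (A : 'I_n -> set Omega) :=
  [/\ forall i, F (A i),
      forall i j, i != j -> A i `&` A j = set0
    & forall w, exists i, A i w].

Definition mi_term (pab pa pb : R) : R :=
  if pab == 0 then 0 else pab * ln (pab / (pa * pb)).

Definition mi_partition_sum n m (A : 'I_n -> set Omega) (B : 'I_m -> set Omega) : R :=
  \sum_(i < n) \sum_(j < m)
     mi_term (fine (P (A i `&` B j))) (fine (P (A i))) (fine (P (B j))).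

(** Mutual information I(X;Y) in bits (Gelfand-Yaglom-Perez / Dobrushin
    definition: supremum over finite measurable partitions). X and Y are
    given by their (finitely many) real coordinates. *)
Definition mutual_info (I J : finType) (X : I -> Omega -> R) (Y : J -> Omega -> R)
  : \bar R :=
  ereal_sup [set v | exists n m (A : 'I_n -> set Omega) (B : 'I_m -> set Omega),
     [/\ is_partition (gen_sigma X) A, is_partition (gen_sigma Y) B
       & v = (mi_partition_sum A B / ln 2)%:E]].

(** real coordinates (real and imaginary parts) of a complex random vector *)
Definition cvec_coords n (X : Omega -> 'cV[C]_n) : 'I_n * bool -> Omega -> R :=
  fun ib w => if ib.2 then complex.Im (X w ib.1 0) else complex.Re (X w ib.1 0).

(** expectation of complex random variables / matrices (entrywise) *)
Definition Ec (f : Omega -> C) : C :=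
  Complex (Rintegral P setT (fun w => complex.Re (f w)))
          (Rintegral P setT (fun w => complex.Im (f w))).

Definition Emx m n (F : Omega -> 'M[C]_(m, n)) : 'M[C]_(m, n) :=
  \matrix_(i, j) Ec (fun w => F w i j).

End Defs.

(** conjugate transpose *)
Definition hadj {R : rcfType} m n (A : 'M[R[i]]_(m, n)) : 'M[R[i]]_(n, m) :=
  map_mx (fun z => z^*) A^T.

(* The cell-free XL-MIMO uplink model                                       *)
Section Model.
Context {R : realType} {d : measure_display} {Omega : measurableType d}.
Local Notation C := R[i].
Variables (M K Nr Ns nr ns : nat).

(** index set of all elementary scalar complex Gaussians:
    entries of W^(mk), entries of x_k, entries of n_m *)
Definition Idx : finType :=
  (('I_M * 'I_K * 'I_nr * 'I_ns) + ('I_K * 'I_Ns) + ('I_M * 'I_Nr))%type.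

Variables (W : 'I_M -> 'I_K -> Omega -> 'M[C]_(nr, ns))
          (x : 'I_K -> Omega -> 'cV[C]_Ns)
          (nz : 'I_M -> Omega -> 'cV[C]_Nr).

Definition scalar_of (i : Idx) (w : Omega) : C :=
  match i with
  | inl (inl (m, k, a, b)) => W m k w a b
  | inl (inr (k, a)) => x k w a 0
  | inr (m, a) => nz m w a 0
  end.

(** all real coordinates of the elementary Gaussians *)
Definition all_coords : Idx * bool -> Omega -> R :=
  fun ib w => if ib.2 then complex.Im (scalar_of ib.1 w)
              else complex.Re (scalar_of ib.1 w).

(** variance of the elementary complex Gaussian i : CN(0,1) for the entries
    of W and x_k, CN(0,sigma_w^2) for the noise entries *)
Definition elem_var (sigma2 : R) (i : Idx) : R :=
  match i with inr _ => sigma2 | _ => 1 end.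

Variables (Ur : 'I_M -> 'M[C]_(Nr, nr)) (Us : 'I_K -> 'M[C]_(Ns, ns))
          (Sg : 'I_M -> 'I_K -> 'M[R]_(nr, ns)).

(** H_mk = U_r^(m) (Sigma^(mk) .* W^(mk)) (U_s^(k))^H *)
Definition chan (m : 'I_M) (k : 'I_K) (w : Omega) : 'M[C]_(Nr, Ns) :=
  Ur m *m (\matrix_(i, j) ((Sg m k i j)%:C%C * W m k w i j)) *m hadj (Us k).

Variables (p sigma2 : R).

(** y_m = sqrt p sum_k H_mk x_k + n_m *)
Definition rx (m : 'I_M) (w : Omega) : 'cV[C]_Nr :=
  (Num.sqrt p)%:C%C *: (\sum_(k < K) chan m k w *m x k w) + nz m w.

(** MR combining V_mk = H_mk; local estimate xcheck_mk = V_mk^H y_m *)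
Definition V_MR (m : 'I_M) (k : 'I_K) (w : Omega) : 'M[C]_(Nr, Ns) := chan m k w.
Definition xcheck (m : 'I_M) (k : 'I_K) (w : Omega) : 'cV[C]_Ns :=
  hadj (V_MR m k w) *m rx m w.
(** CPU estimate xhat_k = (1/M) sum_m xcheck_mk *)
Definition xhat (k : 'I_K) (w : Omega) : 'cV[C]_Ns :=
  (M%:R)^-1 *: \sum_(m < M) xcheck m k w.

Variable P : probability Omega R.

Definition Zmat (m : 'I_M) (k : 'I_K) : 'M[C]_Ns :=
  Emx P (fun w => hadj (chan m k w) *m chan m k w).

Definition Tmat (m : 'I_M) (k : 'I_K) (m' : 'I_M) (l : 'I_K) : 'M[C]_Ns :=
  Emx P (fun w => hadj (chan m k w) *m chan m l w *m hadj (chan m' l w) *m chan m' k w).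

Definition Ek1 (k : 'I_K) : 'M[C]_Ns :=
  (Num.sqrt p)%:C%C *: \sum_(m < M) Zmat m k.

Definition Psik1 (k : 'I_K) : 'M[C]_Ns :=
  p%:C%C *: (\sum_(l < K) \sum_(m < M) \sum_(m' < M) Tmat m k m' l)
  - Ek1 k *m hadj (Ek1 k) + sigma2%:C%C *: \sum_(m < M) Zmat m k.

(** SE_k^(1) = log2 | I + E^H Psi^-1 E | (the determinant is real) *)
Definition SE1 (k : 'I_K) : R :=
  ln (complex.Re (\det (1%:M + hadj (Ek1 k) *m invmx (Psik1 k) *m Ek1 k))) / ln 2.

End Model.

(* Main.v *)
Require Import Defs.
From HB Require Import structures.
From mathcomp Require Import all_boot all_order all_algebra.
From mathcomp Require Import all_classical all_reals all_analysis.
From mathcomp Require Import measurable_realfun.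
From mathcomp Require Import complex ring lra.
Import Order.TTheory GRing.Theory Num.Theory.
Import numFieldNormedType.Exports.
Local Open Scope classical_set_scope.
Local Open Scope ring_scope.
Set Implicit Arguments.
Unset Strict Implicit.
Unset Printing Implicit Defensive.

(** Let [x] be the transmitted vector and [y] the scaled estimate, with
    cross-covariance [E] (of [y] with [x]) and covariance [Psi + E E^*] (of
    [y]); put [Q = 1 + E^* Psi^-1 E] and [A = Q^-1 E^* Psi^-1], the linear MMSE
    estimator, whose error covariance is [Q^-1].  If [q(. | y)] is the density
    of [CN (A y, Q^-1)] and [p] that of [x], the function
    [f (x, y) = ln (q (x | y) / p x)] has mean [ln (det Q)] under the joint law,
    because the error has exactly the covariance used in [q], while
    [exp (f (x, y0))] has mean 1 for each fixed [y0].  The Donsker-Varadhan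
    bound [I (x; y) >= E f - ln (E_x E_y (exp f))] then gives [ln (det Q)],
    whatever the law of the non-Gaussian interference is.

    Mutual information is a supremum over finite partitions, so the variational
    bound is applied to [f] evaluated on a grid.  Factoring [Q = L^* D L] with
    [L] unitriangular writes [f] as a sum of one-dimensional Gaussian
    log-density ratios, the one for a coordinate depending only on coordinates
    of higher index and on [y].  This turns the mean of [exp (f (x, y0))] into
    iterated finite sums, each controlled by a one-dimensional Gaussian
    integral, so no multidimensional change of variables is needed.  The mesh
    tends to zero and dominated convergence handles the mean of [f]. *)

(** * Finite partitions *)


(** The tangent inequality [ln z <= z - 1] at [z = pa * pb * expR c / pab]. Summed over cells it is
    the linearised Donsker-Varadhan bound, where [kappa - 1] stands for the logarithm of the
    exponential moment. *)
Lemma mi_term_ge (R : realType) (pab pa pb c : R) :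
  0 <= pab -> 0 <= pa -> 0 <= pb -> (pab != 0 -> 0 < pa /\ 0 < pb) ->
  pab * c + pab - pa * pb * expR c <= mi_term pab pa pb.
Proof.
move=> pab0 pa0 pb0 H; rewrite /mi_term; case: eqVneq => [->|n0].
  by rewrite mul0r add0r sub0r oppr_le0 mulr_ge0 ?expR_ge0// mulr_ge0.
have [pa1 pb1] := H n0.
have pab1 : 0 < pab by rewrite lt_neqAle eq_sym n0.
have q0 : 0 < pa * pb by rewrite mulr_gt0.
set z := pa * pb * expR c / pab.
have z0 : 0 < z by rewrite divr_gt0// mulr_gt0// expR_gt0.
have -> : pab / (pa * pb) = expR c / z.
  by rewrite /z; field; rewrite !gt_eqF ?expR_gt0.
rewrite lnM ?posrE ?expR_gt0 ?invr_gt0// expRK lnV ?posrE//.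
have : ln z <= z - 1 by rewrite -[X in ln X](subrKC 1 z) le_ln1Dx// ltrBrDl subrr.
rewrite -(ler_pM2l pab1).
have -> : pab * (z - 1) = pa * pb * expR c - pab by rewrite /z; field.
by lra.
Qed.

(* Iterated summation: the coordinate of lowest rank is summed last, so each
   factor is summed while the coordinates it depends on are frozen in [t0]. *)
Lemma sum_ffun_prod_le (R : realType) (I T : finType) (r : I -> nat)
    (F : I -> {ffun I -> T} -> R) (c : R) :
  0 <= c -> (forall i t, 0 <= F i t) ->
  (forall i (t t' : {ffun I -> T}), t i = t' i -> (forall j, (r j < r i)%N -> t j = t' j) ->
     F i t = F i t') ->
  (forall i (t : {ffun I -> T}),
     \sum_(u : T) F i [ffun j => if j == i then u else t j] <= c) ->
  forall (S : {set I}) (t0 : {ffun I -> T}),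
    \sum_(t : {ffun I -> T} | [forall j, (j \notin S) ==> (t j == t0 j)])
       \prod_(i in S) F i t <= c ^+ #|S|.
Proof.
move=> c0 F0 Fdep Fc S; move sS : #|S| => n.
elim: n S sS => [|n IH] S sS t0.
  move: sS => /cards0_eq ->.
  rewrite (big_pred1 t0) ?big_set0// => t.
  apply/forallP/eqP => [H|-> j]; last by rewrite eqxx implybT.
  by apply/ffunP => j; have := H j; rewrite inE => /eqP.
have [i0 i0S] : exists i, i \in S by apply/card_gt0P; rewrite sS.
case: (arg_minnP r i0S) => i iS0 imin; have iS : i \in S := iS0.
rewrite (partition_big (fun t : {ffun I -> T} => t i) predT)//=.
pose upd u := [ffun j => if j == i then u else t0 j].
(* By minimality of the rank, all coordinates other than [i] that enter [F i] lie outside [S]. On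
   the fibre [t i = u] the factor [F i t] is thus the constant [F i (upd u)], and the induction
   hypothesis for [S :\ i], frozen at [upd u], bounds the rest. *)
apply: (@le_trans _ _ (\sum_(u : T) F i (upd u) * c ^+ n)); last first.
  by rewrite -mulr_suml exprS ler_wpM2r ?exprn_ge0//; exact: Fc.
apply: ler_sum => u _.
have sS' : #|S :\ i| = n by move: (cardsD1 i S); rewrite iS sS => -[].
apply: le_trans (ler_wpM2l (F0 i (upd u)) (IH _ sS' (upd u))).
rewrite mulr_sumr le_eqVlt; apply/orP; left; apply/eqP.
apply: eq_big => [t|t /andP[/forallP tS /eqP tu]].
  apply/andP/forallP => [[/forallP tS /eqP tu] j|H].
    rewrite !inE negb_and negbK ffunE; case: eqVneq => [->|ji] /=.
      by rewrite tu eqxx.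
    exact: tS.
  split.
    apply/forallP => j; apply/implyP => jS; have := H j.
    rewrite !inE negb_and negbK jS orbT/= ffunE; case: (eqVneq j i) => // ji.
    by move: jS; rewrite ji iS.
  by have := H i; rewrite !inE eqxx/= ffunE eqxx.
rewrite (bigD1 i)//=; congr (_ * _).
  apply: Fdep => [|j ji]; first by rewrite ffunE eqxx.
  rewrite ffunE; case: eqVneq => [->//|_].
  have := tS j; case jS : (j \in S) => /=; last by move/eqP.
  by have := imin _ jS; rewrite leqNgt ji.
by apply: eq_bigl => j; rewrite !inE andbC.
Qed.

Section FiniteMaps.
Context {R : realType} {d : measure_display} {Omega : measurableType d}.
Variable P : probability Omega R.

Lemma Rintegral_probability_cst (c : R) : \int[P]_w c = c.
Proof. by rewrite /Rintegral integral_cst//= probability_setT mule1. Qed.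

Lemma Rintegral_finite_range (T : finType) (k : Omega -> T) (g : T -> R) :
  (forall t, measurable (k @^-1` [set t])) ->
  \int[P]_w g (k w) = \sum_t fine (P (k @^-1` [set t])) * g t.
Proof.
move=> mk.
have -> : (fun w => g (k w)) =
    (fun w => \sum_t g t * \1_(k @^-1` [set t]) w).
  apply/funext => w; rewrite (bigD1 (k w))//= indicE mem_set// mulr1.
  rewrite big1 ?addr0// => t tk; rewrite indicE memNset ?mulr0// => /= kt.
  by rewrite kt eqxx in tk.
rewrite /Rintegral; under eq_integral do rewrite -sumEFin.
rewrite integral_sum//=; last first.
  move=> t; under eq_fun do rewrite EFinM.
  apply: integrableZl => //.
  exact: integrable_indic.
have Ei t : (\int[P]_x (g t * \1_(k @^-1` [set t]) x)%:E =
    (g t * fine (P (k @^-1` [set t])))%:E)%E.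
  rewrite EFinM fineK ?fin_num_measure//; under eq_integral do rewrite EFinM.
  rewrite integralZl//=; last exact: integrable_indic.
  by rewrite integral_indic// setIT.
under eq_bigr do rewrite Ei.
by rewrite sumEFin/=; apply: eq_bigr => t _; rewrite mulrC.
Qed.

(** The fibres of [kX] and [kY] form admissible partitions; blocks may be empty, so no surjectivity
    is required. *)
Lemma mutual_info_ge_fin (I J S T : finType) (X : I -> Omega -> R)
    (Y : J -> Omega -> R) (kX : Omega -> S) (kY : Omega -> T) :
  (forall s, gen_sigma X (kX @^-1` [set s])) ->
  (forall t, gen_sigma Y (kY @^-1` [set t])) ->
  (((\sum_s \sum_t mi_term (fine (P (kX @^-1` [set s] `&` kY @^-1` [set t])))
     (fine (P (kX @^-1` [set s]))) (fine (P (kY @^-1` [set t])))) / ln 2)%:E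
   <= mutual_info P X Y)%E.
Proof.
move=> mX mY; apply: ereal_sup_ubound => /=.
have part (V U : finType) (Z : V -> Omega -> R) (k : Omega -> U) :
    (forall s, gen_sigma Z (k @^-1` [set s])) ->
    is_partition (gen_sigma Z) (fun i : 'I_#|U| => k @^-1` [set enum_val i]).
  move=> mk; split => [i//|i j ij|w].
  - apply/seteqP; split => // u [/= -> /enum_val_inj e].
    by rewrite e eqxx in ij.
  - by exists (enum_rank (k w)) => /=; rewrite enum_rankK.
exists #|S|, #|T|, (fun i => kX @^-1` [set enum_val i]),
  (fun i => kY @^-1` [set enum_val i]); split; [exact: part|exact: part|].
congr ((_ / _)%:E); rewrite /mi_partition_sum.
rewrite (reindex (@enum_val S predT)) /=; last first.
  by apply: onW_bij; exact: enum_val_bij.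
apply: eq_bigr => i _.
by rewrite (reindex (@enum_val T predT))//=; apply: onW_bij; exact: enum_val_bij.
Qed.

(* Donsker-Varadhan bound for the test function [c (kX w) (kY w)]. *)
Lemma mi_sum_ge (S T : finType) (kX : Omega -> S) (kY : Omega -> T)
    (c : S -> T -> R) (kappa : R) :
  (forall s, measurable (kX @^-1` [set s])) ->
  (forall t, measurable (kY @^-1` [set t])) ->
  (forall t, \sum_s fine (P (kX @^-1` [set s])) * expR (c s t) <= kappa) ->
  \int[P]_w c (kX w) (kY w) + 1 - kappa <=
  \sum_s \sum_t mi_term (fine (P (kX @^-1` [set s] `&` kY @^-1` [set t])))
     (fine (P (kX @^-1` [set s]))) (fine (P (kY @^-1` [set t]))).
Proof.
move=> mX mY Hc.
pose pa s := fine (P (kX @^-1` [set s])).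
pose pb t := fine (P (kY @^-1` [set t])).
pose pab s t := fine (P (kX @^-1` [set s] `&` kY @^-1` [set t])).
pose k w := (kX w, kY w).
have kE u : k @^-1` [set u] = kX @^-1` [set u.1] `&` kY @^-1` [set u.2].
  by apply/seteqP; split => w /=; rewrite /k; case: u => s t /= [-> ->].
have mk u : measurable (k @^-1` [set u]) by rewrite kE; exact: measurableI.
have p0 A : 0 <= fine (P A) by exact: fine_ge0.
have Ec : \int[P]_w c (kX w) (kY w) = \sum_s \sum_t pab s t * c s t.
  rewrite (Rintegral_finite_range (fun u => c u.1 u.2) mk) pair_bigA/=.
  by apply: eq_bigr => u _; rewrite kE.
have E1 : \sum_s \sum_t pab s t = 1.
  have := Rintegral_finite_range (fun=> 1) mk.
  rewrite Rintegral_probability_cst => ->.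
  rewrite pair_bigA/=; by apply: eq_bigr => u _; rewrite kE mulr1.
have Eb : \sum_t pb t = 1.
  have := Rintegral_finite_range (fun=> 1) mY.
  rewrite Rintegral_probability_cst => ->.
  by apply: eq_bigr => u _; rewrite mulr1.
(* In the sum of the termwise bounds the first two terms give the mean of [c] and 1. The subtracted
   one is an average, with weights [pb t], of the sums bounded by [kappa]. *)
apply: (@le_trans _ _
    (\sum_s \sum_t (pab s t * c s t + pab s t - pa s * pb t * expR (c s t)))).
  under eq_bigr do rewrite sumrB big_split/=.
  rewrite sumrB big_split/= -Ec E1 lerB// exchange_big/=.
  rewrite -[leRHS]mul1r -Eb mulr_suml; apply: ler_sum => t _.
  rewrite -[X in X <= _](_ : pb t * \sum_s pa s * expR (c s t) = _).
    by rewrite ler_wpM2l// p0.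
  by rewrite mulr_sumr; apply: eq_bigr => s _; ring.
apply: ler_sum => s _; apply: ler_sum => t _; apply: mi_term_ge; rewrite ?p0// => n0.
have pab0 : 0 < pab s t by rewrite lt_neqAle eq_sym n0 p0.
have mle A B : measurable A -> measurable B -> A `<=` B ->
    fine (P A) <= fine (P B).
  move=> mA mB AB; apply: fine_le; rewrite ?fin_num_measure//.
  by apply: le_measure; rewrite ?inE.
split; apply: (lt_le_trans pab0); apply: mle; rewrite //.
- exact: measurableI.
- exact: measurableI.
Qed.

End FiniteMaps.

(** * Integrals against a normal distribution *)


Section NormalIntegrals.
Context {R : realType}.
Local Notation mu := (@lebesgue_measure R).

(** The Radon-Nikodym derivative of the normal law has the same integral as [normal_pdf] over every
    measurable set, so the two agree almost everywhere. *)
Lemma ge0_integral_normal_prob (m s : R) (f : R -> \bar R) :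
  measurable_fun setT f -> (forall x, 0 <= f x)%E ->
  (\int[normal_prob m s]_x f x = \int[mu]_x (f x * (normal_pdf m s x)%:E))%E.
Proof.
move=> mf f0; have dom := normal_prob_dominates m s.
rewrite -(Radon_Nikodym_SigmaFinite.change_of_variables dom f0)//.
have mpdf : measurable_fun setT (EFin \o normal_pdf m s).
  by apply/measurable_EFinP; exact: measurable_normal_pdf.
have mrn : measurable_fun setT
    (Radon_Nikodym_SigmaFinite.f (normal_prob m s) mu).
  exact: measurable_int (Radon_Nikodym_SigmaFinite.f_integrable dom).
apply: ae_eq_integral => //.
- exact: emeasurable_funM.
- exact: emeasurable_funM.
- apply: ae_eqe_mul2l => /=; apply: integral_ae_eq => //=.
  + exact: Radon_Nikodym_SigmaFinite.f_integrable.
  + by move=> E _ mE; rewrite -Radon_Nikodym_SigmaFinite.f_integral.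
Qed.

Lemma integral_normal_prob (m s : R) (f : R -> R) :
  (normal_prob m s).-integrable setT (EFin \o f) ->
  mu.-integrable setT (fun x => (f x * normal_pdf m s x)%:E) /\
  (\int[normal_prob m s]_x (f x)%:E = \int[mu]_x (f x * normal_pdf m s x)%:E)%E.
Proof.
move=> intf; have mf := measurable_int _ intf.
have mf' : measurable_fun setT f by exact/measurable_EFinP.
have mpdf : measurable_fun setT (normal_pdf m s) by exact: measurable_normal_pdf.
have intfp : mu.-integrable setT (fun x => (f x * normal_pdf m s x)%:E).
  apply/integrableP; split; first exact/measurable_EFinP/measurable_funM.
  move/integrableP : intf => [_].
  rewrite ge0_integral_normal_prob//; last exact: measurableT_comp.
  apply: le_lt_trans; rewrite le_eqVlt; apply/orP; left; apply/eqP.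
  apply: eq_integral => x _ /=.
  by rewrite -EFinM normrM [X in _ * X]ger0_norm// normal_pdf_ge0.
split=> //; rewrite integralE [RHS]integralE.
rewrite !ge0_integral_normal_prob//; try exact: measurable_funepos;
  try exact: measurable_funeneg.
congr (_ - _)%E; apply: eq_integral => x _.
- by rewrite !funeposE -!EFin_max -EFinM maxr_pMl ?normal_pdf_ge0// mul0r.
- rewrite !funenegE -!EFinN -!EFin_max -EFinM maxr_pMl ?normal_pdf_ge0// mul0r.
  by rewrite mulNr.
Qed.

Lemma normal_pdf0E (s x : R) : s != 0 ->
  normal_pdf 0 s x = normal_peak s * expR (- x ^+ 2 / (s ^+ 2 *+ 2)).
Proof. by move=> s0; rewrite /normal_pdf (negbTE s0) /normal_fun subr0. Qed.

(** Completing the square: an exponential tilt with [e] equal to 1 or -1 shifts the mean of the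
    density and multiplies it by a constant. *)
Lemma expR_normal_pdf0 (s e x : R) : s != 0 -> e ^+ 2 = 1 ->
  expR (e * x) * normal_pdf 0 s x =
  expR (s ^+ 2 / 2) * normal_pdf (e * s ^+ 2) s x.
Proof.
move=> s0 e1; rewrite normal_pdf0E// /normal_pdf (negbTE s0) /normal_fun.
rewrite mulrCA [RHS]mulrCA; congr (_ * _); rewrite -!expRD; congr expR.
have -> : (x - e * s ^+ 2) ^+ 2 = x ^+ 2 - e * s ^+ 2 * x *+ 2 + s ^+ 4.
  rewrite (_ : s ^+ 4 = e ^+ 2 * s ^+ 4); last by rewrite e1 mul1r.
  by ring.
by field.
Qed.

Lemma normr_exprn_le (x : R) n :
  `|x| ^+ n <= n`!%:R * (expR x + expR (- x)).
Proof.
have H (y : R) : 0 <= y -> y ^+ n <= n`!%:R * expR y.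
  move=> y0; case: n => [|n].
    by rewrite expr0 fact0 mul1r -expR0 ler_expR.
  rewrite -ler_pdivrMl ?ltr0n ?fact_gt0// mulrC.
  by apply: le_trans (expR_ge1Dxn n y0); rewrite lerDr.
have [x0|x0] := leP 0 x.
  rewrite ger0_norm// (le_trans (H _ x0))// ler_wpM2l// lerDl expR_ge0//.
rewrite ltr0_norm// (le_trans (H _ _))//; first by rewrite oppr_ge0 ltW.
by rewrite ler_wpM2l// lerDr expR_ge0.
Qed.

(** A power is at most [n!] times [expR x + expR (- x)], and tilting turns this bound into two
    shifted normal densities, each of mass 1. *)
Lemma integrable_normal_expn (s : R) n : s != 0 ->
  (normal_prob 0 s).-integrable setT (fun x => (x ^+ n)%:E).
Proof.
move=> s0; apply/integrableP; split.
  by apply/measurable_EFinP; exact: measurable_funX.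
rewrite ge0_integral_normal_prob//; last first.
  by apply: measurableT_comp => //; apply/measurable_EFinP; exact: measurable_funX.
pose g (x : R) : \bar R := ((n`!%:R * expR (s ^+ 2 / 2))%:E *
  ((normal_pdf (1 * s ^+ 2) s x)%:E + (normal_pdf (-1 * s ^+ 2) s x)%:E))%E.
have ig e : mu.-integrable setT (fun x => (normal_pdf (e * s ^+ 2) s x)%:E).
  exact: integrable_normal_pdf.
have : (\int[mu]_x g x < +oo)%E.
  rewrite /g integralZl//=; last by apply: integrableD => //; exact: ig.
  by rewrite integralD//= !integral_normal_pdf -EFinD -EFinM ltry.
apply: le_lt_trans; apply: ge0_le_integral => //=.
- by move=> x _; rewrite mule_ge0// lee_fin normal_pdf_ge0.
- apply/measurable_EFinP/measurable_funM; last exact: measurable_normal_pdf.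
  by apply: measurableT_comp => //; exact: measurable_funX.
- apply: emeasurable_funM => //; apply: emeasurable_funD;
  by apply/measurable_EFinP; exact: measurable_normal_pdf.
- move=> x _; rewrite /g -EFinD -!EFinM lee_fin.
  have h1 : 1 ^+ 2 = 1 :> R by rewrite expr1n.
  have h2 : (-1) ^+ 2 = 1 :> R by rewrite sqrrN.
  rewrite -mulrA mulrDr -(expR_normal_pdf0 x s0 h1) -(expR_normal_pdf0 x s0 h2).
  rewrite -mulrDl mulrA.
  by rewrite ler_wpM2r ?normal_pdf_ge0// normrX mul1r mulN1r normr_exprn_le.
Qed.

(** The fundamental theorem of calculus on growing symmetric intervals, passed to the limit by
    dominated convergence. It serves as integration by parts for the first two Gaussian moments. *)
Lemma integralT_derive_eq0 (f F : R -> R) :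
  continuous f -> (forall x : R, is_derive x 1 F (f x)) ->
  mu.-integrable setT (EFin \o f) ->
  (fun n => F n.+1%:R - F (- n.+1%:R)) @ \oo --> 0 ->
  (\int[mu]_x (f x)%:E = 0)%E.
Proof.
move=> cf dF intf F0.
have cF : continuous F.
  move=> x; apply: differentiable_continuous; apply/derivable1_diffP.
  by have := dF x => -[].
pose I_ n : set R := `[(- n.+1%:R), n.+1%:R]%classic.
have step n : (\int[mu]_x ((EFin \o f) \_ (I_ n)) x =
    (F n.+1%:R - F (- n.+1%:R))%:E)%E.
  rewrite -integral_mkcond (@continuous_FTC2 _ f F)//.
  - by rewrite gtrN.
  - exact: continuous_subspaceT.
  - split => //.
    + exact: cvg_at_right_filter (cF _).
    + exact: cvg_at_left_filter (cF _).
  - by move=> x _; rewrite derive1E; exact: derive_val.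
have lim1 : (fun n => \int[mu]_x ((EFin \o f) \_ (I_ n)) x)%E @ \oo -->
    (\int[mu]_x (f x)%:E)%E.
  apply: (@dominated_cvg _ _ _ mu setT _ _ _ (abse \o EFin \o f)) => //=.
  - move=> n; apply/(measurable_restrictT _ _).1; first exact: measurable_itv.
    by have := measurable_int _ intf; exact: measurable_funS.
  - move=> x _; apply: cvg_near_cst.
    exists (Num.truncn `|x|) => // n /= xn; rewrite patchE mem_set// /I_ /= in_itv/=.
    rewrite -ler_norml; apply/ltW/(lt_le_trans (truncnS_gt _)).
    by rewrite ler_nat ltnS.
  - exact: integrable_abse.
  - move=> n x _; rewrite patchE; case: ifPn => //= _.
    by rewrite normr0 lee_fin.
have lim2 : (fun n => \int[mu]_x ((EFin \o f) \_ (I_ n)) x)%E @ \oo --> 0%E.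
  under eq_fun do rewrite step.
  by apply: cvg_EFin; [exact: nearW|exact: F0].
exact: cvg_unique lim1 lim2.
Qed.

Lemma is_derive_normal_pdf0 (s x : R) : s != 0 ->
  is_derive x 1 (normal_pdf 0 s) (- (x / s ^+ 2) * normal_pdf 0 s x).
Proof.
move=> s0.
have -> : normal_pdf 0 s = (fun y => normal_peak s * expR (- y ^+ 2 / (s ^+ 2 *+ 2))).
  by apply/funext => y; rewrite normal_pdf0E.
apply: is_derive_eq; rewrite /GRing.scale/= !mulr1 !mulr0 ?addr0.
by field.
Qed.

(** From [1 + y <= expR y] with [y] the square of [n.+1] over [2 s^2], the product is at most a
    constant over [n.+1]. *)
Lemma normal_pdf_tail (s : R) : s != 0 ->
  (fun n => n.+1%:R * normal_pdf 0 s n.+1%:R) @ \oo --> (0 : R).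
Proof.
move=> s0; have s2 : 0 < s ^+ 2 by rewrite exprn_even_gt0.
have p0 := normal_peak_ge0 s.
apply: (@squeeze_cvgr _ _ _ _ (fun=> 0)
    (fun n => (normal_peak s * (s ^+ 2 *+ 2)) * n.+1%:R^-1)).
- apply: nearW => n; apply/andP; split; first by rewrite mulr_ge0// normal_pdf_ge0.
  rewrite normal_pdf0E// mulrCA -mulrA ler_wpM2l// mulNr expRN.
  rewrite ler_pdivrMr ?expR_gt0//.
  apply: (@le_trans _ _ ((s ^+ 2 *+ 2) / n.+1%:R *
      (1 + n.+1%:R ^+ 2 / (s ^+ 2 *+ 2)))); last first.
    by rewrite ler_wpM2l ?expR_ge1Dx// divr_ge0// mulrn_wge0 ?ltW.
  rewrite mulrDr mulr1.
  have -> : s ^+ 2 *+ 2 / n.+1%:R * (n.+1%:R ^+ 2 / (s ^+ 2 *+ 2)) = n.+1%:R :> R.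
    by field; rewrite s0 nat1r pnatr_eq0.
  by rewrite lerDr divr_ge0// mulrn_wge0 ?ltW.
- exact: cvg_cst.
- rewrite -[X in _ --> X](mulr0 (normal_peak s * (s ^+ 2 *+ 2))).
  apply: cvgMl_tmp; exact: cvg_harmonic.
Qed.

Lemma normal_pdf0N (s x : R) : s != 0 -> normal_pdf 0 s (- x) = normal_pdf 0 s x.
Proof. by move=> s0; rewrite !normal_pdf0E// sqrrN. Qed.

(** The integrand has the primitive [- s ^+ 2 * normal_pdf 0 s x], which is even, so the boundary
    terms cancel. *)
Lemma integral_normal_id (s : R) : s != 0 ->
  (\int[normal_prob 0 s]_x x%:E = 0)%E.
Proof.
move=> s0; have [] := @integral_normal_prob 0 s id.
  by have := integrable_normal_expn 1 s0; under eq_fun do rewrite expr1.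
move=> intx ->.
apply: (@integralT_derive_eq0 _ (fun x => - s ^+ 2 * normal_pdf 0 s x)) => //.
- move=> x; apply: cvgM => //; exact: continuous_normal_pdf.
- move=> x; have d := is_derive_normal_pdf0 x s0.
  by apply: is_derive_eq; rewrite /GRing.scale/= ?mulr0 ?addr0; field.
- under eq_fun do rewrite normal_pdf0N// subrr.
  exact: cvg_cst.
Qed.

(** The function [- s ^+ 2 * (x * normal_pdf 0 s x)] is a primitive of
    [(x ^+ 2 - s ^+ 2) * normal_pdf 0 s x] and vanishes at infinity, so the second moment is
    [s ^+ 2] times the total mass. *)
Lemma integral_normal_sqr (s : R) : s != 0 ->
  (\int[normal_prob 0 s]_x (x ^+ 2)%:E = (s ^+ 2)%:E)%E.
Proof.
move=> s0; have [] := @integral_normal_prob 0 s (fun x => x ^+ 2).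
  exact: integrable_normal_expn.
move=> intx ->.
have ipdf := integrable_normal_pdf 0 s.
have H : (\int[mu]_x (x ^+ 2 * normal_pdf 0 s x - s ^+ 2 * normal_pdf 0 s x)%:E = 0)%E.
  apply: (@integralT_derive_eq0 _ (fun x => - s ^+ 2 * (x * normal_pdf 0 s x))).
  - move=> x; apply: cvgB; apply: cvgM; try exact: continuous_normal_pdf.
      exact: exprn_continuous.
    exact: cvg_cst.
  - move=> x; have d := is_derive_normal_pdf0 x s0.
    apply: is_derive_eq; rewrite /GRing.scale/= ?mulr0 ?addr0 ?mulr1; by field.
  - have := integrableB measurableT intx (integrableZl measurableT (s ^+ 2) ipdf).
    by apply: eq_integrable => // w _; rewrite /= EFinB EFinM.
  - have := @cvgMl_tmp _ _ _ eventually_filter _ (- s ^+ 2 *+ 2) _ (normal_pdf_tail s0).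
    rewrite mulr0; apply: cvg_trans; apply: near_eq_cvg; apply: nearW => n.
    by rewrite normal_pdf0N//; ring.
move: H; under eq_integral do rewrite EFinB.
rewrite integralB//=; last by under eq_fun do rewrite EFinM; exact: integrableZl.
under [X in (_ - X)%E]eq_integral do rewrite EFinM.
rewrite integralZl//= integral_normal_pdf mule1.
rewrite -(fineK (integrable_fin_num measurableT intx)) -EFinB.
by move=> -[/subr0_eq ->].
Qed.

End NormalIntegrals.

(** * Moments and independence *)


Lemma normrM_le_sqrD (R : realDomainType) (x y : R) :
  `|x * y| <= x ^+ 2 + y ^+ 2.
Proof. by rewrite ler_norml; apply/andP; split; nra. Qed.

Section Moments.
Context {R : realType} {d : measure_display} {Omega : measurableType d}.
Variable P : probability Omega R.

(** Finiteness of all moments is stable under sums and products, so every polynomial in the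
    Gaussians is integrable at once. The family [G] records what a variable depends on, for use with
    independence; it need not consist of measurable sets, hence the two measurability clauses. *)
Definition rmom (G : set (set Omega)) (f : Omega -> R) : Prop :=
  [/\ @measurable_fun _ _ (g_sigma_algebraType G) R setT f,
      measurable_fun setT f
    & forall n, P.-integrable setT (fun w => (f w ^+ n)%:E)].

Section Closure.
Variable G : set (set Omega).

Lemma rmom_cst c : rmom G (fun=> c).
Proof.
split=> [||n]; [exact: measurable_cst|exact: measurable_cst|].
exact: finite_measure_integrable_cst.
Qed.

(** Dominated through [normrM_le_sqrD] by the even powers [2a] of [f] and [2b] of [g]. *)
Lemma rmom_integrable_exp2 f g a b : rmom G f -> rmom G g ->
  P.-integrable setT (fun w => (f w ^+ a * g w ^+ b)%:E).
Proof.
move=> [_ mf If] [_ mg Ig].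
apply: (@le_integrable _ _ _ P _ _ _
    (fun w => ((f w ^+ (a * 2))%:E + (g w ^+ (b * 2))%:E)%E)) => //.
- apply/measurable_EFinP; apply: measurable_funM; exact: measurable_funX.
- move=> w _; rewrite -EFinD/= lee_fin !exprM.
  by rewrite [leRHS]ger0_norm ?addr_ge0 ?sqr_ge0// normrM_le_sqrD.
- exact: integrableD.
Qed.

Lemma rmomM f g : rmom G f -> rmom G g -> rmom G (fun w => f w * g w).
Proof.
move=> Hf Hg; split=> [||n].
- by case: Hf Hg => [? _ _] [? _ _]; exact: measurable_funM.
- by case: Hf Hg => [_ ? _] [_ ? _]; exact: measurable_funM.
- by under eq_fun do rewrite exprMn; exact: rmom_integrable_exp2.
Qed.

Lemma integrable_sumr (I : Type) (r : seq I) (f : I -> Omega -> R) :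
  (forall i, P.-integrable setT (EFin \o f i)) ->
  P.-integrable setT (fun w => (\sum_(i <- r) f i w)%:E).
Proof.
move=> If; elim: r => [|i r IH].
  under eq_fun do rewrite big_nil; exact: integrable0.
have := integrableD measurableT (If i) IH.
by apply: eq_integrable => // w _; rewrite big_cons EFinD.
Qed.

Lemma rmomD f g : rmom G f -> rmom G g -> rmom G (fun w => f w + g w).
Proof.
move=> Hf Hg; split=> [||n].
- by case: Hf Hg => [? _ _] [? _ _]; exact: measurable_funD.
- by case: Hf Hg => [_ ? _] [_ ? _]; exact: measurable_funD.
- under eq_fun do rewrite exprDn.
  apply: integrable_sumr => i.
  have := rmom_integrable_exp2 (n - i) i Hf Hg.
  move=> /(integrableZl measurableT ('C(n, i))%:R).
  by apply: eq_integrable => // w _ /=; rewrite -EFinM mulr_natl.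
Qed.

Lemma rmomZ c f : rmom G f -> rmom G (fun w => c * f w).
Proof. exact/rmomM/rmom_cst. Qed.

Lemma rmomN f : rmom G f -> rmom G (fun w => - f w).
Proof. by under [X in _ -> rmom _ X]eq_fun do rewrite -mulN1r; exact: rmomZ. Qed.

Lemma rmomB f g : rmom G f -> rmom G g -> rmom G (fun w => f w - g w).
Proof. by move=> Hf /rmomN; exact: rmomD. Qed.

Lemma rmomX f n : rmom G f -> rmom G (fun w => f w ^+ n).
Proof.
move=> Hf; elim: n => [|n IH]; first exact: rmom_cst.
by under eq_fun do rewrite exprS; exact: rmomM.
Qed.

Lemma rmom_sum (I : Type) (r : seq I) (f : I -> Omega -> R) :
  (forall i, rmom G (f i)) -> rmom G (fun w => \sum_(i <- r) f i w).
Proof.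
move=> Hf; elim: r => [|i r IH].
  by under eq_fun do rewrite big_nil; exact: rmom_cst.
by under eq_fun do rewrite big_cons; exact: rmomD.
Qed.

Lemma rmom_int f : rmom G f -> P.-integrable setT (EFin \o f).
Proof. by case=> _ _ /(_ 1%N); under eq_fun do rewrite expr1. Qed.

Lemma rmom_RintegralD f g : rmom G f -> rmom G g ->
  \int[P]_w (f w + g w) = \int[P]_w f w + \int[P]_w g w.
Proof. by move=> Hf Hg; rewrite RintegralD//; exact: rmom_int. Qed.

Lemma rmom_RintegralZ c f : rmom G f ->
  \int[P]_w (c * f w) = c * \int[P]_w f w.
Proof. by move=> Hf; rewrite RintegralZl//; exact: rmom_int. Qed.

Lemma rmom_Rintegral_sum (I : Type) (r : seq I) (f : I -> Omega -> R) :
  (forall i, rmom G (f i)) ->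
  \int[P]_w (\sum_(i <- r) f i w) = \sum_(i <- r) \int[P]_w f i w.
Proof.
move=> Hf; elim: r => [|i r IH].
  under eq_Rintegral do rewrite big_nil.
  by rewrite big_nil /Rintegral integral0.
under eq_Rintegral do rewrite big_cons.
by rewrite rmom_RintegralD ?IH ?big_cons//; exact: rmom_sum.
Qed.

End Closure.

Lemma rmomS (G G' : set (set Omega)) f : G `<=` G' -> rmom G f -> rmom G' f.
Proof.
move=> GG' [mf mf' If]; split => // _ B mB.
by have := mf measurableT _ mB; apply: (sub_smallest2r (smallest_sigma_algebra _ _) GG').
Qed.

(** Independence identifies the joint law of [(f, g)] with the product of the marginal laws, and
    Fubini's theorem splits the integral of the product of the coordinates. *)
Lemma indep_expectation_mul (G G' : set (set Omega)) f g :
  (forall A B, <<s G >> A -> <<s G' >> B -> P (A `&` B) = (P A * P B)%E) ->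
  rmom G f -> rmom G' g ->
  \int[P]_w (f w * g w) = \int[P]_w f w * \int[P]_w g w.
Proof.
move=> ind Hf Hg; have [mf mf' If] := Hf; have [mg mg' Ig] := Hg.
pose h w := (f w, g w).
have mh : measurable_fun setT h by exact: measurable_fun_pair.
pose f' : {mfun Omega >-> R} := HB.pack f (isMeasurableFun.Build _ _ _ _ _ mf').
pose g' : {mfun Omega >-> R} := HB.pack g (isMeasurableFun.Build _ _ _ _ _ mg').
pose h' : {mfun Omega >-> (R * R)%type} := HB.pack h (isMeasurableFun.Build _ _ _ _ _ mh).
have hE X : measurable X ->
    (distribution P f' \x distribution P g')%E X = distribution P h' X.
  move=> mX; apply: product_measure_unique => // A B mA mB.
  apply: (ind (f @^-1` A) (g @^-1` B)).
    by have := mf measurableT _ mA; rewrite setTI.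
  by have := mg measurableT _ mB; rewrite setTI.
pose k (z : R * R) := (z.1 * z.2)%:E.
have mk : measurable_fun setT k.
  by apply/measurable_EFinP; apply: measurable_funM; [exact: measurable_fst|exact: measurable_snd].
have ifg : P.-integrable setT (EFin \o (fun w => f w * g w)).
  apply: (@le_integrable _ _ _ P _ _ _
    (fun w => ((f w ^+ 2)%:E + (g w ^+ 2)%:E)%E)) => //.
  - by apply/measurable_EFinP; exact: measurable_funM.
  - move=> w _; rewrite -EFinD/= lee_fin.
    by rewrite [leRHS]ger0_norm ?addr_ge0 ?sqr_ge0// normrM_le_sqrD.
  - exact: integrableD.
have ik : (distribution P f' \x distribution P g')%E.-integrable setT k.
  apply/integrableP; split => //.
  rewrite (eq_measure_integral (distribution P h'))//; last by move=> A mA _; exact: hE.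
  rewrite ge0_integral_distribution; last 2 first.
  - exact: measurableT_comp.
  - by move=> z; exact: abse_ge0.
  by have /integrableP[] := ifg.
have -> : \int[P]_w (f w * g w) =
    fine (\int[distribution P f' \x distribution P g']_z k z)%E.
  rewrite (eq_measure_integral (distribution P h'))//; last by move=> A mA _; exact: hE.
  rewrite integral_pushforward//= ?preimage_setT//.
rewrite -integral12_prod_meas1//= /k/=.
have mE : measurable_fun setT (EFin : R -> \bar R) by exact/measurable_EFinP.
have iF : (distribution P f').-integrable setT (fun x => x%:E).
  exact: (@integrable_pushforward _ _ _ _ _ f mf' P setT EFin mE (rmom_int Hf)
    measurableT).
have iG : (distribution P g').-integrable setT (fun x => x%:E).
  exact: (@integrable_pushforward _ _ _ _ _ g mg' P setT EFin mE (rmom_int Hg)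
    measurableT).
have EG : (\int[distribution P g']_y y%:E = (\int[P]_w g w)%:E)%E.
  rewrite integral_pushforward//= ?preimage_setT; last exact: rmom_int Hg.
  by rewrite /Rintegral fineK//; apply: integrable_fin_num => //; exact: rmom_int Hg.
transitivity (fine (\int[distribution P f']_x (x%:E * (\int[P]_w g w)%:E))%E).
  congr fine; apply: eq_integral => u _; rewrite /fubini_F/=.
  by under eq_integral do rewrite EFinM; rewrite integralZl// EG.
rewrite integralZr// fineM//; last exact: integrable_fin_num.
congr (_ * _); rewrite integral_pushforward//= ?preimage_setT//.
exact: rmom_int Hf.
Qed.

(** * Independence of the sigma-algebras generated by disjoint subfamilies *)

Section MutualIndependence.
Variables (I : finType) (X : I -> Omega -> R).
Hypothesis mX : forall i, measurable_fun setT (X i).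
Hypothesis indX : mutually_independent P X.

Definition cyl (S : {set I}) : set (set Omega) :=
  [set A | exists i B, [/\ i \in S, measurable B & A = X i @^-1` B]].

(** Finite intersections of the generators in [cyl S]: a pi-system, as uniqueness of measures
    demands. *)
Definition rect (S : {set I}) : set (set Omega) :=
  [set A | exists B : I -> set R, (forall i, measurable (B i)) /\
    A = \bigcap_(i in [set j | j \in S]) (X i @^-1` B i)].

Lemma rect_setT S : rect S setT.
Proof.
exists (fun=> setT); split => //; apply/esym; rewrite -subTset => w _ i _ //.
Qed.

Lemma rect_setI S : setI_closed (rect S).
Proof.
move=> _ _ [B [mB ->]] [C [mC ->]]; exists (fun i => B i `&` C i); split.
  by move=> i; exact: measurableI.
by rewrite -bigcapI; apply: eq_bigcapr => i _; rewrite preimage_setI.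
Qed.

Lemma rect_measurable S : rect S `<=` measurable.
Proof.
move=> _ [B [mB ->]]; apply: fin_bigcap_measurable => // i _.
by rewrite -[X in measurable X]setTI; exact: mX.
Qed.

Lemma cyl_sub_rect S : cyl S `<=` rect S.
Proof.
move=> _ [i [B [iS mB ->]]]; exists (fun j => if j == i then B else setT).
split; first by move=> j; case: ifP.
apply/seteqP; split => w /= Hw.
  by move=> j _; case: ifPn => // /eqP ->.
by have := Hw i iS; rewrite eqxx.
Qed.

(** As [S] and [T] are disjoint, the two families of Borel sets glue to one family on the union, and
    the product over the union splits. *)
Lemma rect_indep (S T : {set I}) A B : disjoint (mem S) (mem T) ->
  rect S A -> rect T B -> P (A `&` B) = (P A * P B)%E.
Proof.
move=> dST [A' [mA ->]] [B' [mB ->]].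
pose C i := if i \in S then A' i else B' i.
have mC i : measurable (C i) by rewrite /C; case: ifP.
have CT i : i \in T -> C i = B' i.
  move=> iT; rewrite /C; case: ifPn => // iS.
  by have /disjoint_setI0/setP/(_ i) := dST; rewrite !inE iS iT.
have -> : \bigcap_(i in [set j | j \in S]) (X i @^-1` A' i) `&`
    \bigcap_(i in [set j | j \in T]) (X i @^-1` B' i) =
    \bigcap_(i in [set j | j \in (S :|: T)%SET]) (X i @^-1` C i).
  apply/seteqP; split => w /=.
    move=> [HS HT] i /=; rewrite inE => /orP[iS|iT].
      by rewrite /C iS; exact: HS.
    by rewrite CT//; exact: HT.
  move=> H; split => i /= iS.
    by have := H i; rewrite /= /C iS; apply; rewrite inE iS.
  by have := H i; rewrite /= CT//; apply; rewrite inE iS orbT.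
rewrite !indX//.
rewrite (eq_bigl [predU S & T]); last by move=> i; rewrite !inE.
rewrite bigU//=.
congr (_ * _)%E; apply: eq_bigr => i iS.
  by rewrite /C iS.
by rewrite CT.
Qed.

(** Pi-system uniqueness, applied to one event at a time: for fixed [B0], the maps sending [A] to
    [P (A & B0)] and to [P A * P B0] are finite measures that agree on rectangles. The statement
    [ext] is used first to extend [A], then to extend [B]. *)
Lemma sigma_rect_indep (S T : {set I}) A B : disjoint (mem S) (mem T) ->
  <<s rect S >> A -> <<s rect T >> B -> P (A `&` B) = (P A * P B)%E.
Proof.
have ext (G : set (set Omega)) (mG : G `<=` measurable) (GI : setI_closed G)
    (GT : G setT) (B0 : set Omega) : measurable B0 ->
    (forall A, G A -> P (A `&` B0) = (P A * P B0)%E) ->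
    forall A, <<s G >> A -> P (A `&` B0) = (P A * P B0)%E.
  move=> mB GB A0 sA.
  have pB : (0 <= fine (P B0))%R by exact: fine_ge0.
  rewrite muleC -[in RHS](fineK (fin_num_measure P _ mB)).
  apply: (g_sigma_algebra_measure_unique G mG (fun=> setT) _ _
    (mrestr P mB) (mscale (NngNum pB) P) GI _ _ A0 sA).
  - by [].
  - by rewrite bigcup_const.
  - move=> A1 GA.
    change (P (A1 `&` B0) = ((fine (P B0))%:E * P A1)%E).
    by rewrite GB// muleC fineK// fin_num_measure.
  - move=> _; change (P (setT `&` B0) < +oo)%E.
    by rewrite setTI; apply: le_lt_trans (probability_le1 P mB) (ltry _).
move=> dST sA sB.
have mS := @rect_measurable S; have mT := @rect_measurable T.
have mB : measurable B.
  by apply: (smallest_sub _ mT) sB; exact: sigma_algebra_measurable.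
apply: (ext (rect S)) => //; [exact: rect_setI|exact: rect_setT|].
move=> A' rA; rewrite setIC muleC.
apply: (ext (rect T)) => //; [exact: rect_setI|exact: rect_setT|exact: mS|].
by move=> B' rB; rewrite setIC muleC; exact: (rect_indep dST).
Qed.

Lemma cyl_indep (S T : {set I}) A B : disjoint (mem S) (mem T) ->
  <<s cyl S >> A -> <<s cyl T >> B -> P (A `&` B) = (P A * P B)%E.
Proof.
move=> dST sA sB; apply: (sigma_rect_indep dST).
  by apply: (sub_smallest2r (smallest_sigma_algebra _ _) (@cyl_sub_rect S)).
by apply: (sub_smallest2r (smallest_sigma_algebra _ _) (@cyl_sub_rect T)).
Qed.

Lemma expectation_mul_cyl (S T : {set I}) f g : disjoint (mem S) (mem T) ->
  rmom (cyl S) f -> rmom (cyl T) g ->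
  \int[P]_w (f w * g w) = \int[P]_w f w * \int[P]_w g w.
Proof. by move=> dST; apply: indep_expectation_mul => A B; exact: cyl_indep. Qed.

Lemma rmom_cyl (S : {set I}) i : i \in S ->
  (forall n, P.-integrable setT (fun w => (X i w ^+ n)%:E)) ->
  rmom (cyl S) (X i).
Proof.
move=> iS IX; split => // _ B mB; rewrite setTI.
by apply: sub_sigma_algebra; exists i, B.
Qed.

End MutualIndependence.

End Moments.

(** * Grid approximation of Gaussian test functions *)


Section Grid.
Context {R : realType}.

(* The cells have length [m^-2]; points outside [[-m, m]] are sent to the cell of
   [0], whose index is [m^3]. *)
Definition grid_idx (m : nat) (t : R) : 'I_((2 * m ^ 3).+1) :=
  inord (if `|t| <= m%:R then Num.truncn ((t + m%:R) * m%:R ^+ 2) else (m ^ 3)%N).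

Definition grid_pt (m : nat) (u : 'I_((2 * m ^ 3).+1)) : R :=
  u%:R / m%:R ^+ 2 - m%:R.

Definition grid m t := grid_pt (grid_idx m t).

Lemma grid_idx_val m t : `|t| <= m%:R ->
  0 <= (t + m%:R) * m%:R ^+ 2 /\
  (grid_idx m t = Num.truncn ((t + m%:R) * m%:R ^+ 2) :> nat).
Proof.
rewrite /grid_idx => tm; rewrite tm; move: tm; rewrite ler_norml => /andP[tl tu].
have z0 : 0 <= (t + m%:R) * m%:R ^+ 2 by rewrite mulr_ge0 ?sqr_ge0//; lra.
split=> //; rewrite inordK// ltnS Num.Theory.truncn_le_nat.
apply: (@le_lt_trans _ _ ((m%:R + m%:R) * m%:R ^+ 2)).
  by rewrite ler_wpM2r ?sqr_ge0// lerD2r.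
by rewrite -natr1 natrM natrX ltr_pwDr//; lra.
Qed.

Lemma grid_idx_out m t : ~~ (`|t| <= m%:R) -> grid_idx m t = (m ^ 3)%N :> nat.
Proof.
move=> tm; rewrite /grid_idx (negbTE tm) inordK// ltnS mul2n -addnn leq_addr//.
Qed.

Lemma grid_close m t : (0 < m)%N -> `|t| <= m%:R ->
  `|grid m t - t| <= (m%:R ^+ 2)^-1.
Proof.
move=> m0 tm; have [z0 e] := grid_idx_val tm.
have m2 : 0 < m%:R ^+ 2 :> R by rewrite exprn_gt0// ltr0n.
have /andP[z1 z2] := truncn_itv z0.
rewrite /grid /grid_pt e; move: z1 z2; set n := Num.truncn _ => z1 z2.
have -> : n%:R / m%:R ^+ 2 - m%:R - t = (n%:R - (t + m%:R) * m%:R ^+ 2) / m%:R ^+ 2.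
  by field; rewrite pnatr_eq0 -lt0n.
rewrite normrM normfV (gtr0_norm m2) ler_pdivrMr// mulVf ?gt_eqF//.
by rewrite ler_norml; apply/andP; split; move: z2; rewrite -natr1; lra.
Qed.

Lemma grid_out m t : (0 < m)%N -> ~~ (`|t| <= m%:R) -> grid m t = 0.
Proof.
move=> m0 tm; rewrite /grid /grid_pt grid_idx_out// natrX exprSr mulrAC divff ?mul1r ?subrr//.
by rewrite expf_eq0/= pnatr_eq0 -lt0n.
Qed.

Lemma grid_pt_le m (u : 'I_((2 * m ^ 3).+1)) : (0 < m)%N -> `|grid_pt u| <= m%:R.
Proof.
move=> m0; have m2 : 0 < m%:R ^+ 2 :> R by rewrite exprn_gt0// ltr0n.
have : (u <= 2 * m ^ 3)%N by rewrite -ltnS.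
rewrite -(ler_nat R) natrM natrX exprS => hu.
have h1 : u%:R / m%:R ^+ 2 <= 2 * m%:R :> R by rewrite ler_pdivrMr//; move: hu; rewrite exprSr; lra.
have h2 : 0 <= u%:R / m%:R ^+ 2 :> R by rewrite divr_ge0// ltW.
by rewrite /grid_pt ler_norml; apply/andP; split; lra.
Qed.

Lemma grid_le m t : (0 < m)%N -> `|grid m t| <= `|t| + 1.
Proof.
move=> m0; case: (boolP (`|t| <= m%:R)) => tm; last first.
  by rewrite grid_out// normr0 addr_ge0.
rewrite -[grid m t](subrK t) (le_trans (ler_normD _ _))// addrC lerD2l.
apply: le_trans (grid_close m0 tm) _; rewrite invf_le1 ?exprn_gt0 ?ltr0n//.
by rewrite exprn_ege1// ler1n.
Qed.

Lemma cvg_grid t : (fun n => grid n.+1 t) @ \oo --> t.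
Proof.
apply/subr_cvg0/norm_cvg0P.
apply: (@squeeze_cvgr _ _ _ _ (fun=> 0) (fun n => n.+1%:R^-1)).
- exists (Num.truncn `|t|) => // n /= tn; rewrite normr_ge0/=.
  apply: le_trans (grid_close _ _) _ => //.
    by apply/ltW/(lt_le_trans (truncnS_gt _)); rewrite ler_nat ltnS.
  rewrite lef_pV2 ?posrE ?exprn_gt0 ?ltr0n// expr2 ler_peMr ?ler0n// ler1n//.
- exact: cvg_cst.
- exact: cvg_harmonic.
Qed.

Lemma measurable_grid_idx m (u : 'I_((2 * m ^ 3).+1)) : (0 < m)%N ->
  measurable (grid_idx m @^-1` [set u]).
Proof.
move=> m0; have m2 : 0 < m%:R ^+ 2 :> R by rewrite exprn_gt0// ltr0n.
have -> : grid_idx m @^-1` [set u] =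
   (`[(- m%:R), m%:R]%classic `&`
      `[(u%:R / m%:R ^+ 2 - m%:R), (u.+1%:R / m%:R ^+ 2 - m%:R)[%classic) `|`
   (~` `[(- m%:R), m%:R]%classic `&` [set _ | u = (m ^ 3)%N :> nat]) :> set R.
  apply/seteqP; split => t /=; rewrite !in_itv/= -ler_norml.
    case: (boolP (`|t| <= m%:R)) => tm tu.
      left; split => //; have [z0 e] := grid_idx_val tm.
      have /andP[] := truncn_itv z0; rewrite -e tu => h1 h2.
      by rewrite lerBlDr ler_pdivrMr// h1/= ltrBrDr ltr_pdivlMr.
    by right; split; [exact/negP|rewrite -tu grid_idx_out].
  case=> [[tm /andP[h1 h2]]|[/negP tm e]]; apply/val_inj.
    have [z0 e] := grid_idx_val tm; rewrite /= e; apply/eqP; rewrite truncn_eq//.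
    by move: h1 h2; rewrite lerBlDr ler_pdivrMr// => ->; rewrite ltrBrDr ltr_pdivlMr.
  by rewrite /= grid_idx_out.
apply: measurableU; apply: measurableI; try exact: measurable_itv.
  by apply: measurableC; exact: measurable_itv.
case: (eqVneq (u : nat) (m ^ 3)%N) => e.
  by rewrite (_ : [set _ | _] = setT)//; apply/seteqP; split => // x _; exact: e.
by rewrite (_ : [set _ | _] = set0)//; apply/seteqP; split => // t /= /eqP; rewrite (negbTE e).
Qed.

End Grid.

Lemma measurable_finite_range {R : realType} d (Omega : measurableType d)
    (T : finType) (k : Omega -> T) (g : T -> R) :
  (forall t, measurable (k @^-1` [set t])) ->
  measurable_fun setT (fun w => g (k w)).
Proof.
move=> mk _ B mB; rewrite setTI.
have -> : (fun w => g (k w)) @^-1` B =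
    \bigcup_(t in [set` [set t | g t \in B]%SET]) (k @^-1` [set t]).
  apply/seteqP; split => w /=.
    by move=> Bw; exists (k w) => //=; rewrite inE mem_set.
  by move=> [t /= + ->]; rewrite inE => /set_mem.
exact: fin_bigcup_measurable.
Qed.

Lemma cvg_exprn (R : realType) (u : nat -> R) (l : R) n :
  u @ \oo --> l -> (fun k => u k ^+ n) @ \oo --> l ^+ n.
Proof.
move=> ul; elim: n => [|n IH].
  by under eq_fun do rewrite expr0; rewrite expr0; exact: cvg_cst.
by under eq_fun do rewrite exprS; rewrite exprS; exact: cvgM.
Qed.

(** * One-dimensional Gaussian log-density ratios and their discretisation *)

Section GaussianTest.
Context {R : realType}.
Local Notation mu := (@lebesgue_measure R).

(* [expR (gtest D g t)] is the density of [N(-g, 1/(2D))] relative to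
   [N(0, 1/2)]. *)
Definition gtest (D g t : R) : R := t ^+ 2 - D * (t + g) ^+ 2 + ln D / 2.

Lemma gtest_pdf (D g t : R) : 0 < D ->
  expR (gtest D g t) * normal_pdf 0 (Num.sqrt (1 / 2)) t =
  normal_pdf (- g) (Num.sqrt (1 / (2 * D))) t.
Proof.
move=> D0.
have h0 : 0 < 1 / 2 :> R by lra.
have h1 : 0 < 1 / (2 * D) by rewrite divr_gt0// mulr_gt0.
have s0 : Num.sqrt (1 / 2) != 0 :> R by rewrite gt_eqF// sqrtr_gt0.
have s1 : Num.sqrt (1 / (2 * D)) != 0 by rewrite gt_eqF// sqrtr_gt0.
rewrite /normal_pdf (negbTE s0) (negbTE s1) /normal_fun /normal_peak !sqr_sqrtr ?ltW//.
rewrite subr0 opprK mulrCA -expRD.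
have -> : gtest D g t + - t ^+ 2 / (1 / 2 *+ 2) =
    ln D / 2 + - (t + g) ^+ 2 / (1 / (2 * D) *+ 2).
  by rewrite /gtest; field; rewrite gt_eqF.
rewrite expRD mulrA; congr (_ * _).
have -> : expR (ln D / 2) = Num.sqrt D.
  rewrite -{2}(lnK (x := D)) ?posrE// -[in RHS](divfK (_ : 2 != 0) (ln D))//.
  by rewrite expRM_natr sqrtr_sqr ger0_norm// expR_ge0.
apply: (@mulfI _ (Num.sqrt (1 / 2 * pi *+ 2) * Num.sqrt (1 / (2 * D) * pi *+ 2))).
  by rewrite mulf_neq0// gt_eqF// sqrtr_gt0 -mulr_natl ?mulr_gt0// ?pi_gt0//; lra.
have p0 := pi_gt0 R.
have e : Num.sqrt (1 / (2 * D) * pi *+ 2) * Num.sqrt D = Num.sqrt (1 / 2 * pi *+ 2).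
  rewrite -sqrtrM; last by rewrite mulrn_wge0// mulr_ge0// ltW.
  by congr Num.sqrt; field; rewrite gt_eqF.
have n1 : Num.sqrt (1 / 2 * pi *+ 2) != 0 :> R.
  by rewrite gt_eqF// sqrtr_gt0 pmulrn_lgt0// mulr_gt0.
have n2 : Num.sqrt (1 / (2 * D) * pi *+ 2) != 0 :> R.
  by rewrite gt_eqF// sqrtr_gt0 pmulrn_lgt0// mulr_gt0.
move: n1 n2 e; set u := Num.sqrt _; set v := Num.sqrt _; set w := Num.sqrt _.
move=> n1 n2 e; transitivity (v * w); last by rewrite mulfK.
by field.
Qed.

(** The quadratic [gtest] has slope of order [m] on the window, so a displacement of at most [m^-2]
    changes it by order [1/m]. Hence the choice of cell length. *)
Lemma gtest_grid_le (C D Ds g t : R) m : (0 < m)%N -> 0 < D -> D <= Ds -> 0 <= C ->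
  `|g| <= C * m%:R -> `|t| <= m%:R ->
  gtest D g (grid m t) <= (3 + Ds * (3 + 2 * C)) / m%:R + gtest D g t.
Proof.
move=> m0 D0 DDs C0 gC tm; have := grid_close m0 tm.
have m1 : 1 <= m%:R :> R by rewrite ler1n.
have mp : 0 < m%:R :> R by rewrite ltr0n.
set x := grid m t; set e := (_ ^+ 2)^-1 => xt.
have em : e * m%:R = m%:R^-1 by rewrite /e; field; rewrite gt_eqF.
have e0 : 0 <= e by rewrite invr_ge0 sqr_ge0.
have e1 : e <= m%:R^-1 by rewrite -em ler_peMr.
have -> : gtest D g x = gtest D g t + (x - t) * ((x - t) + 2 * t)
    - D * ((x - t) * ((x - t) + 2 * t + 2 * g)) by rewrite /gtest; ring.
have xm : `|x - t| <= m%:R.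
  apply: le_trans xt (le_trans e1 _).
  by rewrite (le_trans _ m1)// invf_le1.
have b1 : `|(x - t) * ((x - t) + 2 * t)| <= 3 / m%:R.
  rewrite normrM -em mulrCA ler_pM//.
  rewrite (le_trans (ler_normD _ _))// normrM ger0_norm//; lra.
have b2 : `|(x - t) * ((x - t) + 2 * t + 2 * g)| <= (3 + 2 * C) / m%:R.
  rewrite normrM -em mulrCA ler_pM//.
  rewrite (le_trans (ler_normD _ _))// [`|2 * g|]normrM ger0_norm//.
  have := ler_normD (x - t) (2 * t); rewrite [`|2 * t|]normrM ger0_norm//; lra.
have b3 : `|D * ((x - t) * ((x - t) + 2 * t + 2 * g))| <= Ds * ((3 + 2 * C) / m%:R).
  by rewrite normrM (gtr0_norm D0) ler_pM// ltW.
move: b1 b3; rewrite !ler_norml => /andP[_ b1] /andP[b3 _].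
by move: b1 b3; rewrite mulrDl mulrA; lra.
Qed.

(* The second term bounds the contribution of [|t| > m], where the grid point is
   [0] and [expR (gtest D g 0) <= Num.sqrt D], by Chebyshev's inequality. *)
Definition grid_bound (C Ds : R) (m : nat) : R :=
  expR ((3 + Ds * (3 + 2 * C)) / m%:R) + Num.sqrt Ds / m%:R ^+ 2.

(** Discrete form of the fact that [expR (gtest D g t)] has mean 1 under [N(0, 1/2)], with an error
    uniform over offsets [g] of size at most [C * m]. *)
Lemma sum_gtest_le (C D Ds g : R) m : (0 < m)%N -> 0 < D -> D <= Ds -> 0 <= C ->
  `|g| <= C * m%:R ->
  \sum_(u < (2 * m ^ 3).+1)
    fine (normal_prob 0 (Num.sqrt (1 / 2)) (grid_idx m @^-1` [set u])) *
    expR (gtest D g (grid_pt u)) <= grid_bound C Ds m.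
Proof.
move=> m0 D0 DDs C0 gC.
pose s : R := Num.sqrt (1 / 2).
have s0 : s != 0 by rewrite gt_eqF// sqrtr_gt0; lra.
pose Np := normal_prob 0 s : probability _ R.
rewrite -(@Rintegral_finite_range _ _ _ Np _ (@grid_idx R m)
   (fun u => expR (gtest D g (grid_pt u)))); last first.
  by move=> u; exact: measurable_grid_idx.
change (fine (\int[normal_prob 0 s]_t (expR (gtest D g (grid m t)))%:E)%E <=
  grid_bound C Ds m).
have mgrid : measurable_fun setT (fun t => expR (gtest D g (grid m t))).
  apply: (measurable_finite_range (fun u => expR (gtest D g (grid_pt u)))).
  by move=> u; exact: measurable_grid_idx.
have K0 : 0 <= Num.sqrt Ds / m%:R ^+ 2 by rewrite divr_ge0// sqr_ge0.
have mp : 0 < m%:R :> R by rewrite ltr0n.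
have m2 : 0 < m%:R ^+ 2 :> R by rewrite exprn_gt0.
pose e1 := expR ((3 + Ds * (3 + 2 * C)) / m%:R).
pose p1 t := normal_pdf (- g) (Num.sqrt (1 / (2 * D))) t.
(* A majorant valid on the whole line: its first term controls the window, where [gtest_pdf] yields
   a normal density of mass 1; its second uses [t ^+ 2 / m ^+ 2 >= 1] outside. *)
pose G (t : R) : \bar R :=
  (e1%:E * (p1 t)%:E + (Num.sqrt Ds / m%:R ^+ 2)%:E * (t ^+ 2 * normal_pdf 0 s t)%:E)%E.
have ip1 : mu.-integrable setT (fun t => (p1 t)%:E) by exact: integrable_normal_pdf.
have [ip2 E2] := integral_normal_prob (integrable_normal_expn 2 s0).
have IG : (\int[mu]_t G t = (e1 + Num.sqrt Ds / m%:R ^+ 2 * s ^+ 2)%:E)%E.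
  rewrite /G integralD//=; [|exact: integrableZl|exact: integrableZl].
  rewrite !integralZl//= integral_normal_pdf mule1.
  by rewrite -E2 integral_normal_sqr.
have le1 : (\int[normal_prob 0 s]_t (expR (gtest D g (grid m t)))%:E <= \int[mu]_t G t)%E.
  rewrite ge0_integral_normal_prob; last 2 first.
  - exact/measurable_EFinP.
  - by move=> t; rewrite lee_fin expR_ge0.
  apply: ge0_le_integral => //=.
  - by move=> t _; rewrite -EFinM lee_fin mulr_ge0 ?expR_ge0 ?normal_pdf_ge0.
  - apply/measurable_EFinP/measurable_funM => //; exact: measurable_normal_pdf.
  - apply: emeasurable_funD; apply/measurable_EFinP/measurable_funM => //.
      exact: measurable_normal_pdf.
    by apply: measurable_funM; [exact: measurable_funX|exact: measurable_normal_pdf].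
  - move=> t _; rewrite /G -!EFinM -EFinD lee_fin.
    have pdf0 := normal_pdf_ge0 0 s t.
    rewrite /p1 -(gtest_pdf g t D0) -/s [e1 * _]mulrA [_ / _ * (_ * _)]mulrA.
    rewrite -mulrDl ler_wpM2r//.
    case: (boolP (`|t| <= m%:R)) => tm.
      apply: (@le_trans _ _ (e1 * expR (gtest D g t))).
        by rewrite -expRD ler_expR; exact: gtest_grid_le.
      by rewrite lerDl mulr_ge0// sqr_ge0.
    apply: (@le_trans _ _ (Num.sqrt Ds / m%:R ^+ 2 * t ^+ 2)); last first.
      by rewrite lerDr mulr_ge0 ?expR_ge0.
    have h1 : expR (gtest D g (grid m t)) <= Num.sqrt Ds.
      rewrite grid_out// (@le_trans _ _ (expR (ln D / 2)))//.
        rewrite ler_expR /gtest expr0n/= !add0r gerDr oppr_le0.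
        by rewrite mulr_ge0 ?sqr_ge0// ltW.
      rewrite -[ln D / 2]addr0 (_ : expR _ = Num.sqrt D).
        by rewrite ler_sqrt// (le_trans _ DDs)// ltW.
      rewrite addr0 -[X in Num.sqrt X](lnK (x := D)) ?posrE//.
      rewrite -[X in Num.sqrt (expR X)](divfK (_ : 2 != 0))//.
      by rewrite expRM_natr sqrtr_sqr ger0_norm// expR_ge0.
    apply: (le_trans h1); rewrite mulrAC ler_pdivlMr// ler_wpM2l//.
    rewrite -[leRHS]real_normK ?num_real// ler_sqr ?nnegrE// ltW//.
    by rewrite ltNge.
have bnd : e1 + Num.sqrt Ds / m%:R ^+ 2 * s ^+ 2 <= grid_bound C Ds m.
  rewrite lerD2l ler_piMr// /s sqr_sqrtr; lra.
apply: le_trans bnd; rewrite -lee_fin -IG; apply: le_trans (le1).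
rewrite fineK// ge0_fin_numE; last first.
  by apply: integral_ge0 => t _; rewrite lee_fin expR_ge0.
by apply: (@le_lt_trans _ _ (\int[mu]_t G t)%E); [exact: le1|rewrite IG ltry].
Qed.

Lemma cvg_grid_bound C Ds : (fun n => grid_bound C Ds n.+1) @ \oo --> (1 : R).
Proof.
have inv0 : (fun n => n.+1%:R^-1) @ \oo --> (0 : R) by exact: cvg_harmonic.
rewrite -[X in _ --> X](addr0 1); apply: cvgD.
  rewrite -[X in _ --> X]expR0; apply: continuous_cvg; first exact: continuous_expR.
  rewrite -[X in _ --> X](mulr0 (3 + Ds * (3 + 2 * C))); exact: cvgMl_tmp.
rewrite -[X in _ --> X](mulr0 (Num.sqrt Ds)); apply: cvgMl_tmp.
rewrite -[X in _ --> X](expr0n R 2) /=.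
under eq_fun do rewrite -exprVn; exact: cvg_exprn.
Qed.

(** A polynomial envelope in [S], for the dominated convergence argument. *)
Lemma normr_gtest_le (C D g t S : R) : 0 < D -> `|t| <= S -> `|g| <= C * S ->
  `|gtest D g t| <= S ^+ 2 + D * ((1 + C) * S) ^+ 2 + `|ln D|.
Proof.
move=> D0 tS gS; have S0 : 0 <= S by exact: le_trans tS.
have h1 : t ^+ 2 <= S ^+ 2 by rewrite -[leLHS]real_normK ?num_real// ler_sqr ?nnegrE.
have h2 : (t + g) ^+ 2 <= ((1 + C) * S) ^+ 2.
  have tg : `|t + g| <= (1 + C) * S.
    by rewrite mulrDl mul1r (le_trans (ler_normD _ _))// lerD.
  by rewrite -[leLHS]real_normK ?num_real// ler_sqr ?nnegrE// (le_trans _ tg).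
have h3 : `|ln D / 2| <= `|ln D| by rewrite normrM normfV [`|2|]ger0_norm// ler_pdivrMr// ler_peMr// ler1n.
have h4 : D * (t + g) ^+ 2 <= D * ((1 + C) * S) ^+ 2 by rewrite ler_wpM2l// ltW.
have h5 : 0 <= D * (t + g) ^+ 2 by rewrite mulr_ge0 ?sqr_ge0// ltW.
have h6 := sqr_ge0 t.
move: h3; rewrite !ler_norml => /andP[h7 h8].
by rewrite /gtest; apply/andP; split; lra.
Qed.


End GaussianTest.

Lemma cvg_sumr (R : realType) (I : Type) (r : seq I) (u : I -> nat -> R) (l : I -> R) :
  (forall i, u i @ \oo --> l i) ->
  (fun n => \sum_(i <- r) u i n) @ \oo --> \sum_(i <- r) l i.
Proof.
move=> ul; elim: r => [|i r IH].
  by rewrite big_nil; under eq_fun do rewrite big_nil; exact: cvg_cst.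
by rewrite big_cons; under eq_fun do rewrite big_cons; exact: cvgD.
Qed.

(** * Mutual information bound from a triangular Gaussian test function *)

Section GaussianMutualInfo.
Context {R : realType} {d : measure_display} {Omega : measurableType d}.
Variables (P : probability Omega R) (I J : finType).
Variables (X : I -> Omega -> R) (Y : J -> Omega -> R) (G : set (set Omega)).
Variables (r : I -> nat) (a : I -> I -> R) (b : I -> J -> R) (D : I -> R).
Hypothesis rX : forall i, rmom P G (X i).
Hypothesis rY : forall j, rmom P G (Y j).
Hypothesis indX : mutually_independent P X.
Hypothesis lawX : forall i B, measurable B ->
  P (X i @^-1` B) = normal_prob 0 (Num.sqrt (1 / 2)) B.
Hypothesis a_r : forall i j, a i j != 0 -> (r j < r i)%N.
Hypothesis D0 : forall i, 0 < D i.

(** Minus the conditional mean of coordinate [i] in the test density. By [a_r] it involves only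
    coordinates of [u] of strictly lower rank. *)
Definition lin (u : I -> R) (v : J -> R) (i : I) : R :=
  \sum_j a i j * u j + \sum_j b i j * v j.

(** The chain rule for densities along the rank: each summand is the log ratio of a conditional
    Gaussian density of [u i] to the density of [N(0, 1/2)]. *)
Definition qtest (u : I -> R) (v : J -> R) : R :=
  \sum_i gtest (D i) (lin u v i) (u i).

Let C : R := \sum_i (\sum_j `|a i j| + \sum_j `|b i j|).
Let Ds : R := \sum_i D i.

Let C_ge0 : 0 <= C.
Proof. by apply: sumr_ge0 => i _; rewrite addr_ge0 ?sumr_ge0. Qed.

Let D_le i : D i <= Ds.
Proof. by rewrite /Ds (bigD1 i)//= lerDl sumr_ge0// => j _; exact: ltW. Qed.

Let lin_le u v i S : 0 <= S -> (forall i, `|u i| <= S) -> (forall j, `|v j| <= S) ->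
  `|lin u v i| <= C * S.
Proof.
move=> S0 uS vS; apply: (@le_trans _ _ ((\sum_j `|a i j| + \sum_j `|b i j|) * S)).
  rewrite mulrDl (le_trans (ler_normD _ _))// lerD// mulr_suml;
  rewrite (le_trans (ler_norm_sum _ _ _))// ler_sum// => j _;
  by rewrite normrM ler_wpM2l.
rewrite ler_wpM2r// /C [leRHS](bigD1 i)//= lerDl sumr_ge0// => j _.
by rewrite addr_ge0 ?sumr_ge0.
Qed.

Let cell m : finType := 'I_((2 * m ^ 3).+1).
Let kX m w : {ffun I -> cell m} := [ffun i => grid_idx m (X i w)].
Let kY m w : {ffun J -> cell m} := [ffun j => grid_idx m (Y j w)].
Let c m (s : {ffun I -> cell m}) (t : {ffun J -> cell m}) : R :=
  qtest (fun i => grid_pt (s i)) (fun j => grid_pt (t j)).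

Let fiberE (L : finType) (Z : L -> Omega -> R) m (s : {ffun L -> cell m}) :
  (fun w => [ffun i => grid_idx m (Z i w)]) @^-1` [set s] =
  \bigcap_(i in [set j | j \in [set: L]%SET]) (Z i @^-1` (grid_idx m @^-1` [set s i])).
Proof.
apply/seteqP; split => w /= H.
  by move=> i _ /=; rewrite -H ffunE.
by apply/ffunP => i; rewrite ffunE; apply: H; rewrite /= inE.
Qed.

Let gen_fiber (L : finType) (Z : L -> Omega -> R) m (s : {ffun L -> cell m}) :
  (0 < m)%N ->
  gen_sigma Z ((fun w => [ffun i => grid_idx m (Z i w)]) @^-1` [set s]).
Proof.
move=> m0; rewrite fiberE.
apply: (@fin_bigcap_measurable _ (g_sigma_algebraType
  [set A | exists i B, measurable B /\ A = Z i @^-1` B])) => // i _.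
apply: sub_sigma_algebra; exists i; eexists; split; last reflexivity.
exact: measurable_grid_idx.
Qed.

Let measurable_fiber (L : finType) (Z : L -> Omega -> R) m (s : {ffun L -> cell m}) :
  (0 < m)%N -> (forall i, rmom P G (Z i)) ->
  measurable ((fun w => [ffun i => grid_idx m (Z i w)]) @^-1` [set s]).
Proof.
move=> m0 rZ; rewrite fiberE; apply: fin_bigcap_measurable => // i _.
have [_ mZ _] := rZ i.
by rewrite -[X in measurable X]setTI; apply: mZ => //; exact: measurable_grid_idx.
Qed.

(** Independence factors the probability of a cell of [X] into one-dimensional masses, so each
    summand is a product of factors triangular in the rank. Each factor is summed by [sum_gtest_le],
    and [sum_ffun_prod_le] combines them. *)
Let sum_exp_le m t : (0 < m)%N ->
  \sum_s fine (P (@kX m @^-1` [set s])) * expR (@c m s t) <= grid_bound C Ds m ^+ #|I|.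
Proof.
move=> m0.
pose pr (u : cell m) : R :=
  fine (normal_prob 0 (Num.sqrt (1 / 2)) (grid_idx m @^-1` [set u])).
pose F i (s : {ffun I -> cell m}) := pr (s i) *
  expR (gtest (D i) (lin (fun i => grid_pt (s i)) (fun j => grid_pt (t j)) i) (grid_pt (s i))).
have mu u : measurable (grid_idx m @^-1` [set u] : set R) by exact: measurable_grid_idx.
have E s : fine (P (@kX m @^-1` [set s])) * expR (@c m s t) =
    \prod_(i in [set: I]%SET) F i s.
  rewrite /F big_split/=; congr (_ * _).
    rewrite fiberE indX//.
    have El i : P (X i @^-1` (grid_idx m @^-1` [set s i])) = (pr (s i))%:E.
      rewrite (lawX i (mu (s i))) /pr fineK//.
      by apply: fin_num_measure; exact: mu.
    by rewrite (eq_bigr _ (fun i _ => El i)) prodEFin.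
  rewrite /c /qtest expR_sum; apply: eq_bigl => i; by rewrite inE.
under eq_bigr do rewrite E.
have F0 i s : 0 <= F i s by rewrite mulr_ge0 ?expR_ge0// fine_ge0.
have linE i s s' : (forall j, (r j < r i)%N -> s j = s' j) ->
    lin (fun i => grid_pt (s i)) (fun j => grid_pt (t j)) i =
    lin (fun i => @grid_pt R m (s' i)) (fun j => grid_pt (t j)) i.
  move=> ss'; congr (_ + _); apply: eq_bigr => j _.
  by have [->|/a_r/ss' ->//] := eqVneq (a i j) 0; rewrite !mul0r.
have gb0 : 0 <= grid_bound C Ds m.
  by rewrite addr_ge0 ?expR_ge0// divr_ge0// sqr_ge0.
have := @sum_ffun_prod_le R I (cell m) r F (grid_bound C Ds m) gb0 F0 _ _
  [set: I]%SET [ffun=> ord0].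
rewrite cardsT; set S := \sum_(s | _) _ => H.
rewrite (_ : \sum_s _ = S); first apply: H.
- by move=> i s s' e ss'; rewrite /F e (linE _ _ _ ss').
- move=> i s; pose g := lin (fun i => @grid_pt R m (s i)) (fun j => grid_pt (t j)) i.
  have gC : `|g| <= C * m%:R by apply: lin_le => // *; exact: grid_pt_le.
  apply: le_trans (sum_gtest_le m0 (D0 i) (D_le i) C_ge0 gC).
  rewrite le_eqVlt; apply/orP; left; apply/eqP; apply: eq_bigr => u _.
  rewrite /F ffunE eqxx (linE _ _ s)// => j ji; rewrite ffunE; case: eqVneq ji => // ->.
  by rewrite ltnn.
- by apply: eq_bigl => s; apply/esym/forallP => j; rewrite inE.
Qed.

Let mi_ge m : (0 < m)%N ->
  (((\int[P]_w @c m (kX m w) (kY m w) + 1 - grid_bound C Ds m ^+ #|I|) / ln 2)%:E <=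
   mutual_info P X Y)%E.
Proof.
move=> m0.
have := @mutual_info_ge_fin _ _ _ P _ _ _ _ X Y (@kX m) (@kY m)
  (fun s => @gen_fiber I X m s m0) (fun s => @gen_fiber J Y m s m0).
apply: le_trans; rewrite lee_fin ler_pM2r ?invr_gt0 ?ln_gt0 ?ltr1n//.
apply: mi_sum_ge => [s|t|t]; [exact: measurable_fiber|exact: measurable_fiber|].
exact: sum_exp_le.
Qed.

(** Squares in place of absolute values keep this bound on all coordinates polynomial, hence with
    all moments finite. *)
Let Sw w : R := \sum_i (X i w ^+ 2 + 2) + \sum_j (Y j w ^+ 2 + 2).

Let sqr2_ge0 (x : R) : 0 <= x ^+ 2 + 2.
Proof. by rewrite addr_ge0 ?sqr_ge0. Qed.

Let normr_sqr2 (x : R) : `|x| + 1 <= x ^+ 2 + 2.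
Proof.
rewrite -[x ^+ 2]real_normK ?num_real//; have := sqr_ge0 (`|x| - 1).
have : 0 <= `|x| by []. by nra.
Qed.

Let Sw_X i w : `|X i w| + 1 <= Sw w.
Proof.
apply: le_trans (normr_sqr2 _) _; rewrite /Sw (bigD1 i)//= -addrA lerDl.
by rewrite addr_ge0// sumr_ge0.
Qed.

Let Sw_Y j w : `|Y j w| + 1 <= Sw w.
Proof.
apply: le_trans (normr_sqr2 _) _; rewrite /Sw [leRHS]addrC (bigD1 j)//= -addrA lerDl.
by rewrite addr_ge0// sumr_ge0.
Qed.

Let Bw w : R := \sum_i (Sw w ^+ 2 + D i * ((1 + C) * Sw w) ^+ 2 + `|ln (D i)|).

Let rSw : rmom P G Sw.
Proof.
by apply: rmomD; apply: rmom_sum => i; apply: rmomD (rmom_cst _ _ _);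
  apply: rmomX.
Qed.

Let rBw : rmom P G Bw.
Proof.
apply: rmom_sum => i; apply: rmomD (rmom_cst _ _ _); apply: rmomD.
  exact: rmomX.
by apply: rmomZ; apply: rmomX; exact: rmomZ.
Qed.

Let rq : rmom P G (fun w => qtest (X^~ w) (Y^~ w)).
Proof.
have rl i : rmom P G (fun w => lin (X^~ w) (Y^~ w) i).
  by apply: rmomD; apply: rmom_sum => j; exact: rmomZ.
apply: rmom_sum => i; apply: rmomD (rmom_cst _ _ _); apply: rmomB.
  exact: rmomX.
by apply: rmomZ; apply: rmomX; exact: rmomD.
Qed.

(** Dominated convergence: [qtest] is polynomial and the grid points converge, while [grid_le]
    bounds them by [Sw] at every mesh, so that [Bw] dominates. *)
Lemma cvg_int_grid :
  (fun n => \int[P]_w @c n.+1 (kX n.+1 w) (kY n.+1 w)) @ \oo -->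
  \int[P]_w qtest (X^~ w) (Y^~ w).
Proof.
apply: fine_cvg; rewrite fineK; last first.
  by apply: integrable_fin_num => //; exact: rmom_int rq.
apply: (@dominated_cvg _ _ _ P setT _ _ _ (EFin \o Bw)) => //=.
- move=> n; apply/measurable_EFinP.
  pose k w := (kX n.+1 w, kY n.+1 w).
  apply: (measurable_finite_range (fun u => @c n.+1 u.1 u.2) (k := k)) => u.
  have -> : k @^-1` [set u] = kX n.+1 @^-1` [set u.1] `&` kY n.+1 @^-1` [set u.2].
    by apply/seteqP; split => w /=; rewrite /k; case: u => s t /= [-> ->].
  by apply: measurableI; exact: measurable_fiber.
- move=> w _; apply: cvg_EFin; first exact: nearW.
  rewrite /comp/= /c /qtest; apply: cvg_sumr => i; rewrite /gtest.
  have cX j : (fun n => grid_pt (kX n.+1 w j)) @ \oo --> X j w.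
    by under eq_fun do rewrite ffunE; exact: cvg_grid.
  have cY j : (fun n => grid_pt (kY n.+1 w j)) @ \oo --> Y j w.
    by under eq_fun do rewrite ffunE; exact: cvg_grid.
  have cl : (fun n => lin (fun j => grid_pt (kX n.+1 w j))
      (fun j => grid_pt (kY n.+1 w j)) i) @ \oo --> lin (X^~ w) (Y^~ w) i.
    by apply: cvgD; apply: cvg_sumr => j; exact: cvgMl_tmp.
  apply: cvgD; last exact: cvg_cst.
  apply: cvgB; first exact: cvg_exprn.
  by apply: cvgMl_tmp; apply: cvg_exprn; exact: cvgD.
- exact: rmom_int rBw.
- move=> n w _; rewrite lee_fin /c /qtest (le_trans (ler_norm_sum _ _ _))//.
  have uX i : `|grid_pt (kX n.+1 w i)| <= Sw w.
    by rewrite ffunE (le_trans (grid_le _ _))//; exact: Sw_X.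
  have uY i : `|grid_pt (kY n.+1 w i)| <= Sw w.
    by rewrite ffunE (le_trans (grid_le _ _))//; exact: Sw_Y.
  apply: ler_sum => i _; apply: normr_gtest_le => //.
  by apply: lin_le => //; exact: le_trans (uX i).
Qed.

(** As the mesh vanishes, the power of [grid_bound] tends to 1 and cancels the constant 1 of the
    linearised bound. *)
Lemma mutual_info_ge_qtest :
  ((\int[P]_w qtest (X^~ w) (Y^~ w) / ln 2)%:E <= mutual_info P X Y)%E.
Proof.
pose v n := (\int[P]_w @c n.+1 (kX n.+1 w) (kY n.+1 w) + 1 -
  grid_bound C Ds n.+1 ^+ #|I|) / ln 2.
have cv : v @ \oo --> \int[P]_w qtest (X^~ w) (Y^~ w) / ln 2.
  rewrite /v (_ : _ / ln 2 = (\int[P]_w qtest (X^~ w) (Y^~ w) + 1 - 1) / ln 2).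
    2: by rewrite addrK.
  apply: cvgMr_tmp; apply: cvgB.
    by apply: cvgD; [exact: cvg_int_grid|exact: cvg_cst].
  rewrite -[X in _ --> X](expr1n _ #|I|).
  by apply: cvg_exprn; exact: cvg_grid_bound.
have cvE : (fun n => (v n)%:E) @ \oo --> (\int[P]_w qtest (X^~ w) (Y^~ w) / ln 2)%:E.
  by apply: cvg_EFin; [exact: nearW|exact: cv].
rewrite -(cvg_lim _ cvE)//; apply: lime_le; first by apply/cvg_ex; eexists; exact: cvE.
by apply: nearW => n; exact: mi_ge.
Qed.

End GaussianMutualInfo.

(** * Hermitian matrices and linear MMSE estimation *)


Section Adjoint.
Context {R : rcfType}.
Local Notation C := R[i].

Lemma conjCE (z : C) : z^* = Complex (complex.Re z) (- complex.Im z).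
Proof. by case: z. Qed.

Lemma hadjE m n (A : 'M[C]_(m, n)) i j : hadj A i j = (A j i)^*.
Proof. by rewrite !mxE. Qed.

Lemma hadjK m n (A : 'M[C]_(m, n)) : hadj (hadj A) = A.
Proof. by apply/matrixP => i j; rewrite !hadjE conjCK. Qed.

Lemma hadjM m n q (A : 'M[C]_(m, n)) (B : 'M[C]_(n, q)) :
  hadj (A *m B) = hadj B *m hadj A.
Proof.
apply/matrixP => i j; rewrite hadjE !mxE rmorph_sum/=; apply: eq_bigr => k _.
by rewrite !hadjE rmorphM mulrC.
Qed.

Lemma hadjD m n (A B : 'M[C]_(m, n)) : hadj (A + B) = hadj A + hadj B.
Proof. by apply/matrixP => i j; rewrite hadjE !mxE rmorphD. Qed.

Lemma hadjN m n (A : 'M[C]_(m, n)) : hadj (- A) = - hadj A.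
Proof. by apply/matrixP => i j; rewrite hadjE !mxE rmorphN. Qed.

Lemma hadjB m n (A B : 'M[C]_(m, n)) : hadj (A - B) = hadj A - hadj B.
Proof. by rewrite hadjD hadjN. Qed.

Lemma hadjZ m n c (A : 'M[C]_(m, n)) : hadj (c *: A) = c^* *: hadj A.
Proof. by apply/matrixP => i j; rewrite hadjE !mxE rmorphM. Qed.

Lemma hadj0 m n : hadj (0 : 'M[C]_(m, n)) = 0.
Proof. by apply/matrixP => i j; rewrite hadjE !mxE rmorph0. Qed.

Lemma hadj1 n : hadj (1%:M : 'M[C]_n) = 1%:M.
Proof. by apply/matrixP => i j; rewrite hadjE !mxE eq_sym rmorph_nat. Qed.

Lemma hadj_sum (I : Type) (r : seq I) m n (F : I -> 'M[C]_(m, n)) :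
  hadj (\sum_(i <- r) F i) = \sum_(i <- r) hadj (F i).
Proof.
by elim: r => [|i r IH]; rewrite ?big_nil ?hadj0// !big_cons hadjD IH.
Qed.

Lemma hadj_block m1 m2 n1 n2 (A : 'M[C]_(m1, n1)) (B : 'M[C]_(m1, n2))
    (A' : 'M[C]_(m2, n1)) (B' : 'M[C]_(m2, n2)) :
  hadj (block_mx A B A' B') = block_mx (hadj A) (hadj A') (hadj B) (hadj B').
Proof. by rewrite /hadj tr_block_mx map_block_mx. Qed.

Lemma hadj_col m1 m2 n (A : 'M[C]_(m1, n)) (B : 'M[C]_(m2, n)) :
  hadj (col_mx A B) = row_mx (hadj A) (hadj B).
Proof. by rewrite /hadj tr_col_mx map_row_mx. Qed.

Lemma hadj_unitmx n (A : 'M[C]_n) : A \in unitmx -> hadj A \in unitmx.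
Proof.
move=> uA; have /mulmx1_unit[] : hadj A *m hadj (invmx A) = 1%:M.
  by rewrite -hadjM mulVmx// hadj1.
by [].
Qed.

Lemma hadj_invmx n (A : 'M[C]_n) : A \in unitmx ->
  hadj (invmx A) = invmx (hadj A).
Proof.
move=> uA; have uA' := hadj_unitmx uA.
by apply: (can_inj (mulmxK uA')); rewrite mulVmx// -hadjM mulmxV// hadj1.
Qed.

Definition qform n (Q : 'M[C]_n) (v : 'cV[C]_n) : C := (hadj v *m Q *m v) 0 0.

(** In the order of [R[i]], [0 < z] also says that [z] is real. *)
Definition posdef n (Q : 'M[C]_n) : Prop := forall v, v != 0 -> 0 < qform Q v.

Lemma qform1_gt0 n (v : 'cV[C]_n) : v != 0 -> 0 < qform 1%:M v.
Proof.
move=> v0; have [i vi] : exists i, v i 0 != 0.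
  apply/existsP; apply: contraNT v0; rewrite negb_exists => /forallP H.
  by apply/eqP/colP => i; rewrite mxE; apply/eqP; have := H i; rewrite negbK.
rewrite /qform mulmx1 mxE (bigD1 i)//= hadjE ltr_wpDr//.
  by apply: sumr_ge0 => j _; rewrite hadjE mulrC mul_conjC_ge0.
by rewrite mulrC mul_conjC_gt0.
Qed.

Lemma qform_mul n (L : 'M[C]_n) Q (v : 'cV[C]_n) :
  qform (hadj L *m Q *m L) v = qform Q (L *m v).
Proof. by rewrite /qform hadjM !mulmxA. Qed.

(** Elimination of the leading pivot [a]: a unitriangular congruence [L1] reduces [Q] to the blocks
    [a] and [T], the Schur complement, which is again Hermitian and positive definite. *)
Lemma LDL_decomposition n (Q : 'M[C]_n) : hadj Q = Q -> posdef Q ->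
  exists (L : 'M[C]_n) (D : 'rV[R]_n),
    [/\ forall i j : 'I_n, (j < i)%N -> L i j = 0, forall i, L i i = 1,
        forall i, 0 < D 0 i,
        Q = hadj L *m diag_mx (map_mx (real_complex R) D) *m L
      & \det Q = (\prod_i D 0 i)%:C%C].
Proof.
elim: n Q => [|n IH] Q hQ pQ.
  exists 1%:M, 0; split; try by case.
    by rewrite [LHS]flatmx0 [RHS]flatmx0.
  by rewrite det_mx00 big_ord0.
rewrite -[n.+1]/(1 + n)%N in Q hQ pQ *.
pose u := ursubmx Q; pose S := drsubmx Q; pose a := ulsubmx Q 0 0.
have aE : ulsubmx Q = a%:M by rewrite [LHS]mx11_scalar.
have hb : block_mx (hadj a%:M) (hadj (dlsubmx Q)) (hadj u) (hadj S) =
    block_mx a%:M u (dlsubmx Q) S.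
  by rewrite -hadj_block -aE submxK hQ.
have [ha hu _ hS] := eq_block_mx hb.
have lE : dlsubmx Q = hadj u by rewrite -hu hadjK.
have QE : Q = block_mx a%:M u (hadj u) S by rewrite -lE -aE submxK.
(* The pivot is the value of the form at the first basis vector. *)
have a_gt0 : 0 < a.
  pose e : 'cV[C]_(1 + n) := col_mx 1%:M 0.
  have e0 : e != 0.
    apply/eqP => /(congr1 usubmx); rewrite col_mxKu linear0 => /matrixP/(_ 0 0)/eqP.
    by rewrite !mxE eqxx oner_eq0.
  have := pQ _ e0; rewrite /qform QE /e hadj_col hadj1 hadj0.
  by rewrite mul_row_block mul_row_col !(mulmx0, mul0mx, mulmx1, mul1mx, addr0) mxE eqxx.
pose L1 := block_mx 1%:M (a^-1 *: u) 0 1%:M : 'M[C]_(1 + n).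
pose T := S - hadj u *m (a^-1 *: u).
have a0 : a != 0 by rewrite gt_eqF.
have aJ : (a^-1)^* = a^-1 by apply: conj_Creal; rewrite realV gtr0_real.
have Q1 : Q = hadj L1 *m block_mx a%:M 0 0 T *m L1.
  rewrite hadj_block !hadj1 hadj0 hadjZ aJ !mulmx_block.
  rewrite !(mulmx0, mul0mx, mulmx1, mul1mx, addr0, add0r).
  rewrite mul_scalar_mx scalerA divff// scale1r -scalemxAl mul_mx_scalar scalerA.
  rewrite mulVf// scale1r -scalemxAr /T -scalemxAr.
  by rewrite addrC subrK -QE.
have hT : hadj T = T.
  rewrite /T hadjB hS hadjM hadjZ hadjK aJ; congr (_ - _).
  by rewrite -scalemxAl -scalemxAr.
(* The form of [T] at [v] is that of [Q] at the vector [w] which [L1] maps to [v] padded with a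
   leading zero. *)
have pT : posdef T.
  move=> v v0; pose w : 'cV[C]_(1 + n) := col_mx (- ((a^-1 *: u) *m v)) v.
  have Lw : L1 *m w = col_mx 0 v.
    by rewrite /L1 mul_block_col !mul1mx mul0mx add0r addNr.
  have w0 : w != 0.
    apply: contraNneq v0 => w0; move: Lw; rewrite w0 mulmx0 => /esym.
    by rewrite -[RHS]vsubmxK !linear0 => /eq_col_mx[_ ->].
  have := pQ _ w0; rewrite {1}Q1 qform_mul Lw /qform.
  by rewrite hadj_col hadj0 mul_row_block mul_row_col !(mulmx0, mul0mx, add0r).
have [L' [D' [trL' dL' pD' TE dT]]] := IH T hT pT.
pose L := block_mx 1%:M (a^-1 *: u) 0 L' : 'M[C]_(1 + n).
pose D := row_mx (complex.Re a)%:M D' : 'rV[R]_(1 + n).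
have aR : (complex.Re a)%:C%C = a by rewrite RRe_real// gtr0_real.
exists L, D; split.
- move=> k l; rewrite -(splitK k) -(splitK l).
  case: (fintype.split k) => k'; case: (fintype.split l) => l' /=.
  + by rewrite !ord1.
  + by rewrite ord1 ltn0.
  + by rewrite block_mxEdl mxE.
  + by rewrite block_mxEdr ltn_add2l => /trL'.
- move=> k; rewrite -(splitK k); case: (fintype.split k) => k' /=.
  + by rewrite block_mxEul ord1 mxE eqxx.
  + by rewrite block_mxEdr.
- move=> k; rewrite -(splitK k); case: (fintype.split k) => k' /=.
  + by rewrite row_mxEl ord1 mxE eqxx mulr1n -ltcR aR.
  + by rewrite row_mxEr.
- have -> : L = block_mx 1%:M 0 0 L' *m L1.
    by rewrite mulmx_block !(mulmx0, mul0mx, mulmx1, mul1mx, addr0, add0r).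
  rewrite hadjM Q1 -!mulmxA; congr (_ *m _); rewrite !mulmxA; congr (_ *m _).
  rewrite map_row_mx diag_mx_row hadj_block hadj1 !hadj0 !mulmx_block.
  rewrite !(mulmx0, mul0mx, mulmx1, mul1mx, addr0, add0r) -TE.
  congr block_mx; apply/matrixP => i j; rewrite !ord1 !mxE/= !mulr1n.
  by rewrite aR.
- rewrite Q1 hadj_block !hadj1 hadj0 !det_mulmx !det_ublock det_lblock.
  rewrite !det1 !mul1r !mulr1 det_scalar1 dT big_split_ord/= big_ord1.
  rewrite row_mxEl mxE eqxx mulr1n rmorphM/= aR.
  by under [in RHS]eq_bigr do rewrite row_mxEr.
Qed.

Lemma posdef_unitmx n (Q : 'M[C]_n) : hadj Q = Q -> posdef Q -> Q \in unitmx.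
Proof.
move=> hQ pQ; have [L [D [_ _ pD _ dQ]]] := LDL_decomposition hQ pQ.
rewrite unitmxE unitfE dQ; apply/eqP => -[/eqP].
by rewrite gt_eqF// prodr_gt0.
Qed.

Section MMSE.
Variables (n : nat) (E Psi : 'M[C]_n).
Hypothesis uPsi : Psi \in unitmx.
Hypothesis hPsi : hadj Psi = Psi.
Hypothesis psdPsi : forall v, 0 <= qform Psi v.

Definition snr_mx : 'M[C]_n := 1%:M + hadj E *m invmx Psi *m E.
Local Notation Q := snr_mx.

Let hPsiV : hadj (invmx Psi) = invmx Psi.
Proof. by rewrite hadj_invmx// hPsi. Qed.

Lemma hadj_snr_mx : hadj Q = Q.
Proof. by rewrite /snr_mx hadjD hadj1 !hadjM hadjK hPsiV mulmxA. Qed.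

(** The form splits as the squared norm of [v] plus the form of [Psi] at [invmx Psi *m E *m v], so
    semidefiniteness of [Psi] suffices. *)
Lemma posdef_snr_mx : posdef Q.
Proof.
move=> v v0; have -> : qform Q v = qform 1%:M v + qform Psi (invmx Psi *m E *m v).
  rewrite /qform mulmx1 /snr_mx mulmxDr mulmx1 mulmxDl mxE; congr (_ + _).
  congr ((_ : 'M[C]_1) 0 0); rewrite !hadjM hPsiV !mulmxA.
  by rewrite mulmxKV.
by rewrite ltr_wpDr// qform1_gt0.
Qed.

Lemma unitmx_snr_mx : Q \in unitmx.
Proof. exact: posdef_unitmx hadj_snr_mx posdef_snr_mx. Qed.

Definition mmse_mx : 'M[C]_n := invmx Q *m hadj E *m invmx Psi.
Local Notation A := mmse_mx.

(** The left side is the covariance of [x - A y]. It collapses because [A *m E = 1%:M - invmx Q] and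
    [A *m Psi *m hadj A = (1%:M - invmx Q) *m invmx Q]. *)
Lemma mmse_error : 1%:M - A *m E - hadj E *m hadj A +
  A *m (Psi + E *m hadj E) *m hadj A = invmx Q.
Proof.
have uQ := unitmx_snr_mx; have hQ := hadj_snr_mx.
have hQV : hadj (invmx Q) = invmx Q by rewrite hadj_invmx// hQ.
have AE : A *m E = 1%:M - invmx Q.
  rewrite /mmse_mx -!mulmxA (mulmxA (hadj E)).
  rewrite (_ : hadj E *m invmx Psi *m E = Q - 1%:M); last by rewrite /snr_mx addrC addKr.
  by rewrite mulmxBr mulVmx// mulmx1.
have EA : hadj E *m hadj A = 1%:M - invmx Q.
  by rewrite -hadjM AE hadjB hadj1 hQV.
have AP : A *m Psi *m hadj A = (1%:M - invmx Q) *m invmx Q.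
  rewrite -AE /mmse_mx -(mulmxA _ _ Psi) mulVmx// mulmx1 !hadjM hadjK hPsiV hQV.
  by rewrite !mulmxA.
rewrite mulmxDr mulmxDl AP mulmxA -(mulmxA _ (hadj E)) EA AE.
by rewrite -mulmxDr subrKC mulmx1 subrK opprB subrKC.
Qed.

End MMSE.

End Adjoint.

(** * Moments of complex random matrices *)


Section GaussianMoments.
Context {R : realType} {d : measure_display} {Omega : measurableType d}.
Variable P : probability Omega R.
Variables (X : Omega -> R) (s : R).
Hypothesis s0 : s != 0.
Hypothesis mX : measurable_fun setT X.
Hypothesis lawX : forall B, measurable B -> P (X @^-1` B) = normal_prob 0 s B.

Let X' : {mfun Omega >-> measurableTypeR R} :=
  HB.pack X (isMeasurableFun.Build _ _ Omega (measurableTypeR R) X mX).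

Let distE (f : R -> \bar R) :
  (\int[distribution P X']_x f x = \int[normal_prob 0 s]_x f x)%E.
Proof.
rewrite [RHS](eq_measure_integral (distribution P X'))// => A mA _.
exact/esym/lawX.
Qed.

Lemma gaussian_integrable_expn n : P.-integrable setT (fun w => (X w ^+ n)%:E).
Proof.
have mf : measurable_fun setT (fun x : R => (x ^+ n)%:E).
  by apply/measurable_EFinP; exact: measurable_funX.
apply/integrableP; split.
  by apply/measurable_EFinP; exact: measurable_funX.
have /integrableP[_] := integrable_normal_expn n s0.
rewrite -distE ge0_integral_distribution//.
  exact: measurableT_comp.
Qed.

Lemma gaussian_moment n : (\int[P]_w (X w ^+ n)%:E =
  \int[normal_prob 0 s]_x (x ^+ n)%:E)%E.
Proof.
rewrite -distE integral_distribution//.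
  by apply/measurable_EFinP; exact: measurable_funX.
exact: gaussian_integrable_expn.
Qed.

Lemma gaussian_mean : \int[P]_w X w = 0.
Proof.
have := gaussian_moment 1; under eq_integral do rewrite expr1.
under [in RHS]eq_integral do rewrite expr1.
by rewrite integral_normal_id// /Rintegral => ->.
Qed.

Lemma gaussian_second_moment : \int[P]_w (X w * X w) = s ^+ 2.
Proof.
have := gaussian_moment 2; under eq_integral do rewrite expr2.
by rewrite integral_normal_sqr// /Rintegral => ->.
Qed.

End GaussianMoments.

Section ComplexMoments.
Context {R : realType} {d : measure_display} {Omega : measurableType d}.
Variable P : probability Omega R.
Local Notation C := R[i].

Definition cmom (G : set (set Omega)) (f : Omega -> C) : Prop :=
  rmom P G (fun w => complex.Re (f w)) /\ rmom P G (fun w => complex.Im (f w)).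

Definition mmom (G : set (set Omega)) m n (F : Omega -> 'M[C]_(m, n)) : Prop :=
  forall i j, cmom G (fun w => F w i j).

Lemma complexReD (x y : C) : complex.Re (x + y) = complex.Re x + complex.Re y.
Proof. by case: x y => ? ? [? ?]. Qed.
Lemma complexImD (x y : C) : complex.Im (x + y) = complex.Im x + complex.Im y.
Proof. by case: x y => ? ? [? ?]. Qed.
Lemma complexReM (x y : C) : complex.Re (x * y) =
  complex.Re x * complex.Re y - complex.Im x * complex.Im y.
Proof. by case: x y => ? ? [? ?]. Qed.
Lemma complexImM (x y : C) : complex.Im (x * y) =
  complex.Re x * complex.Im y + complex.Im x * complex.Re y.
Proof. by case: x y => ? ? [? ?]. Qed.
Lemma complexReJ (x : C) : complex.Re x^* = complex.Re x.
Proof. by case: x. Qed.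
Lemma complexImJ (x : C) : complex.Im x^* = - complex.Im x.
Proof. by case: x. Qed.
Lemma Re_sum (I : Type) (r : seq I) (f : I -> C) :
  complex.Re (\sum_(i <- r) f i) = \sum_(i <- r) complex.Re (f i).
Proof. by elim: r => [|i r IH]; rewrite ?big_nil// !big_cons complexReD IH. Qed.
Lemma Im_sum (I : Type) (r : seq I) (f : I -> C) :
  complex.Im (\sum_(i <- r) f i) = \sum_(i <- r) complex.Im (f i).
Proof. by elim: r => [|i r IH]; rewrite ?big_nil// !big_cons complexImD IH. Qed.

Lemma cmomS G G' f : G `<=` G' -> cmom G f -> cmom G' f.
Proof. by move=> GG' [? ?]; split; apply: rmomS GG' _. Qed.

Lemma mmomS G G' m n (F : Omega -> 'M[C]_(m, n)) :
  G `<=` G' -> mmom G F -> mmom G' F.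
Proof. by move=> GG' HF i j; exact: cmomS GG' (HF i j). Qed.

Section Closure.
Variable G : set (set Omega).

Lemma cmom_cst c : cmom G (fun=> c).
Proof. by split; exact: rmom_cst. Qed.

Lemma cmomD f g : cmom G f -> cmom G g -> cmom G (fun w => f w + g w).
Proof.
move=> [f1 f2] [g1 g2]; split.
  by under eq_fun do rewrite complexReD; exact: rmomD.
by under eq_fun do rewrite complexImD; exact: rmomD.
Qed.

Lemma cmomM f g : cmom G f -> cmom G g -> cmom G (fun w => f w * g w).
Proof.
move=> [f1 f2] [g1 g2]; split.
  by under eq_fun do rewrite complexReM; apply: rmomB; exact: rmomM.
by under eq_fun do rewrite complexImM; apply: rmomD; exact: rmomM.
Qed.

Lemma cmomJ f : cmom G f -> cmom G (fun w => (f w)^*).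
Proof.
move=> [f1 f2]; split; first by under eq_fun do rewrite complexReJ.
by under eq_fun do rewrite complexImJ; exact: rmomN.
Qed.

Lemma cmom_sum (I : Type) (r : seq I) (f : I -> Omega -> C) :
  (forall i, cmom G (f i)) -> cmom G (fun w => \sum_(i <- r) f i w).
Proof.
move=> Hf; split.
  by under eq_fun do rewrite Re_sum; apply: rmom_sum => i; have [] := Hf i.
by under eq_fun do rewrite Im_sum; apply: rmom_sum => i; have [] := Hf i.
Qed.

Lemma Ec_cst c : Ec P (fun=> c) = c.
Proof. by rewrite /Ec !Rintegral_probability_cst; case: c. Qed.

Lemma EcD f g : cmom G f -> cmom G g -> Ec P (fun w => f w + g w) = Ec P f + Ec P g.
Proof.
move=> [f1 f2] [g1 g2]; rewrite /Ec.
under [in LHS]eq_Rintegral do rewrite complexReD.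
under [X in Complex _ X = _]eq_Rintegral do rewrite complexImD.
by rewrite (rmom_RintegralD f1 g1) (rmom_RintegralD f2 g2).
Qed.

Lemma Ec_sum (I : Type) (r : seq I) (f : I -> Omega -> C) :
  (forall i, cmom G (f i)) ->
  Ec P (fun w => \sum_(i <- r) f i w) = \sum_(i <- r) Ec P (f i).
Proof.
move=> Hf; elim: r => [|i r IH].
  by under eq_fun do rewrite big_nil; rewrite Ec_cst big_nil.
under eq_fun do rewrite big_cons.
by rewrite EcD ?IH ?big_cons//; exact: cmom_sum.
Qed.

Lemma EcZ c f : cmom G f -> Ec P (fun w => c * f w) = c * Ec P f.
Proof.
move=> [f1 f2]; rewrite /Ec.
under [in LHS]eq_Rintegral do rewrite complexReM -mulNr.
under [X in Complex _ X = _]eq_Rintegral do rewrite complexImM.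
rewrite !(rmom_RintegralD (rmomZ _ f1) (rmomZ _ f2)) !(rmom_RintegralZ _ f1) !(rmom_RintegralZ _ f2).
rewrite (rmom_RintegralD (rmomZ _ f2) (rmomZ _ f1)) !(rmom_RintegralZ _ f1) !(rmom_RintegralZ _ f2).
by case: c => c1 c2; rewrite /= mulNr.
Qed.

Lemma EcJ f : cmom G f -> Ec P (fun w => (f w)^*) = (Ec P f)^*.
Proof.
move=> [f1 f2]; rewrite /Ec conjCE/=.
under [in LHS]eq_Rintegral do rewrite complexReJ.
under [X in Complex _ X = _]eq_Rintegral do rewrite complexImJ -mulN1r.
by rewrite (rmom_RintegralZ _ f2) mulN1r.
Qed.

Lemma mmom_cst m n (A : 'M[C]_(m, n)) : mmom G (fun=> A).
Proof. by move=> i j; exact: cmom_cst. Qed.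

Lemma mmomD m n (F H : Omega -> 'M[C]_(m, n)) :
  mmom G F -> mmom G H -> mmom G (fun w => F w + H w).
Proof. by move=> mF mH i j; under eq_fun do rewrite mxE; exact: cmomD. Qed.

Lemma mmom_sum (I : Type) (r : seq I) m n (F : I -> Omega -> 'M[C]_(m, n)) :
  (forall i, mmom G (F i)) -> mmom G (fun w => \sum_(i <- r) F i w).
Proof.
move=> mF i j; under eq_fun do rewrite summxE.
by apply: cmom_sum => k; exact: mF.
Qed.

Lemma mmomM m n q (F : Omega -> 'M[C]_(m, n)) (H : Omega -> 'M[C]_(n, q)) :
  mmom G F -> mmom G H -> mmom G (fun w => F w *m H w).
Proof.
move=> mF mH i j; under eq_fun do rewrite mxE.
by apply: cmom_sum => k; exact: cmomM.
Qed.

Lemma mmomZ m n c (F : Omega -> 'M[C]_(m, n)) :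
  mmom G F -> mmom G (fun w => c *: F w).
Proof.
by move=> mF i j; under eq_fun do rewrite mxE; apply: cmomM (cmom_cst _) _.
Qed.

Lemma mmom_hadj m n (F : Omega -> 'M[C]_(m, n)) :
  mmom G F -> mmom G (fun w => hadj (F w)).
Proof. by move=> mF i j; under eq_fun do rewrite hadjE; exact: cmomJ. Qed.

Lemma EmxD m n (F H : Omega -> 'M[C]_(m, n)) : mmom G F -> mmom G H ->
  Emx P (fun w => F w + H w) = Emx P F + Emx P H.
Proof.
move=> mF mH; apply/matrixP => i j; rewrite !mxE.
by under eq_fun do rewrite mxE; exact: EcD.
Qed.

Lemma Emx_sum (I : Type) (r : seq I) m n (F : I -> Omega -> 'M[C]_(m, n)) :
  (forall i, mmom G (F i)) ->
  Emx P (fun w => \sum_(i <- r) F i w) = \sum_(i <- r) Emx P (F i).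
Proof.
move=> mF; apply/matrixP => i j; rewrite summxE !mxE.
under eq_fun do rewrite summxE.
rewrite Ec_sum; last by move=> k; exact: mF.
by apply: eq_bigr => k _; rewrite mxE.
Qed.

Lemma EmxMl m n q (A : 'M[C]_(m, n)) (F : Omega -> 'M[C]_(n, q)) : mmom G F ->
  Emx P (fun w => A *m F w) = A *m Emx P F.
Proof.
move=> mF; apply/matrixP => i j; rewrite !mxE.
under eq_fun do rewrite mxE.
rewrite Ec_sum; last by move=> k; apply: cmomM (cmom_cst _) _; exact: mF.
by apply: eq_bigr => k _; rewrite mxE EcZ//; exact: mF.
Qed.

Lemma Emx_hadj m n (F : Omega -> 'M[C]_(m, n)) : mmom G F ->
  Emx P (fun w => hadj (F w)) = hadj (Emx P F).
Proof.
move=> mF; apply/matrixP => i j; rewrite hadjE !mxE.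
by under eq_fun do rewrite hadjE; exact: EcJ.
Qed.

Lemma EmxMr m n q (A : 'M[C]_(n, q)) (F : Omega -> 'M[C]_(m, n)) : mmom G F ->
  Emx P (fun w => F w *m A) = Emx P F *m A.
Proof.
move=> mF; rewrite -[RHS]hadjK hadjM -Emx_hadj// -EmxMl; last exact: mmom_hadj.
rewrite -Emx_hadj; last by apply: mmomM; [exact: mmom_cst|exact: mmom_hadj].
by congr Emx; apply/funext => w; rewrite hadjM !hadjK.
Qed.

Lemma EmxZ m n c (F : Omega -> 'M[C]_(m, n)) : mmom G F ->
  Emx P (fun w => c *: F w) = c *: Emx P F.
Proof.
move=> mF; rewrite -mul_scalar_mx -EmxMl//.
by congr Emx; apply/funext => w; rewrite mul_scalar_mx.
Qed.

(** The form is the mean of the squared modulus of [hadj (z w) *m v]. The order on [R[i]] also asks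
    that the imaginary part vanish. *)
Lemma qform_Emx_ge0 n (z : Omega -> 'cV[C]_n) (v : 'cV[C]_n) : mmom G z ->
  0 <= qform (Emx P (fun w => z w *m hadj (z w))) v.
Proof.
move=> mz; have mzz : mmom G (fun w => z w *m hadj (z w)).
  by apply: mmomM => //; exact: mmom_hadj.
rewrite /qform -EmxMl// -EmxMr; last by apply: mmomM => //; exact: mmom_cst.
rewrite mxE /Ec lecE/=; apply/andP; split.
  rewrite (_ : (fun w => _) = fun=> 0) ?Rintegral_probability_cst//.
  apply/funext => w; rewrite mulmxA -mulmxA -[X in _ *m X]hadjK hadjM hadjK.
  by rewrite mxE big_ord1 hadjE -normCK complexImM; rewrite normc_def/=; ring.
apply: Rintegral_ge0 => w _; rewrite mulmxA -mulmxA -[X in _ *m X]hadjK hadjM hadjK.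
rewrite mxE big_ord1 hadjE complexReM complexReJ complexImJ mulrN opprK.
by rewrite addr_ge0// -expr2 sqr_ge0.
Qed.

End Closure.

Section Independence.
Variables (I : finType) (X : I -> Omega -> R).
Hypothesis mX : forall i, measurable_fun setT (X i).
Hypothesis indX : mutually_independent P X.

Lemma cylS (S T : {set I}) : S \subset T -> cyl X S `<=` cyl X T.
Proof. by move=> /fintype.subsetP ST _ [i [B [/ST iT mB ->]]]; exists i, B. Qed.

Lemma cyl_subT (S : {set I}) : cyl X S `<=` cyl X [set: I]%SET.
Proof. by apply: cylS; exact: finset.subsetT. Qed.

Section Disjoint.
Variables S T : {set I}.
Hypothesis dST : disjoint (mem S) (mem T).

Lemma EcM_indep f g : cmom (cyl X S) f -> cmom (cyl X T) g ->
  Ec P (fun w => f w * g w) = Ec P f * Ec P g.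
Proof.
move=> [f1 f2] [g1 g2].
have sS : cyl X S `<=` cyl X [set: I]%SET by exact: cyl_subT.
have sT : cyl X T `<=` cyl X [set: I]%SET by exact: cyl_subT.
have F1 := rmomS sS f1; have F2 := rmomS sS f2.
have G1 := rmomS sT g1; have G2 := rmomS sT g2.
rewrite /Ec.
under [in LHS]eq_Rintegral do rewrite complexReM -mulN1r.
under [X in Complex _ X = _]eq_Rintegral do rewrite complexImM.
rewrite (rmom_RintegralD (rmomM F1 G1) (rmomZ (-1) (rmomM F2 G2))).
rewrite (rmom_RintegralZ (-1) (rmomM F2 G2)) (rmom_RintegralD (rmomM F1 G2) (rmomM F2 G1)).
rewrite !(expectation_mul_cyl mX indX dST)//.
by rewrite mulN1r.
Qed.

(** Entrywise, the product is a sum of outer factors times an entry of [V]; independence replaces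
    that entry by its mean even though [F] and [H] may be dependent. *)
Lemma Emx_sandwich m n q l (F : Omega -> 'M[C]_(m, n)) (V : Omega -> 'M[C]_(n, q))
    (H : Omega -> 'M[C]_(q, l)) :
  mmom (cyl X S) F -> mmom (cyl X T) V -> mmom (cyl X S) H ->
  Emx P (fun w => F w *m V w *m H w) = Emx P (fun w => F w *m Emx P V *m H w).
Proof.
move=> mF mV mH; apply/matrixP => i j; rewrite [LHS]mxE [RHS]mxE.
have sS : cyl X S `<=` cyl X [set: I]%SET by exact: cyl_subT.
have sT : cyl X T `<=` cyl X [set: I]%SET by exact: cyl_subT.
have E (U : Omega -> 'M[C]_(n, q)) w : (F w *m U w *m H w) i j =
    \sum_a \sum_b F w i b * H w a j * U w b a.
  rewrite mxE; apply: eq_bigr => a _; rewrite mxE mulr_suml.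
  by apply: eq_bigr => b _; rewrite mulrAC.
under eq_fun do rewrite E.
under [in RHS]eq_fun do rewrite (E (fun=> Emx P V)).
have mFH a b : cmom (cyl X S) (fun w => F w i b * H w a j) by exact: cmomM.
rewrite !(Ec_sum (G := cyl X [set: I]%SET)).
- apply: eq_bigr => a _; rewrite !(Ec_sum (G := cyl X [set: I]%SET)).
  + apply: eq_bigr => b _; rewrite EcM_indep//.
    under [in RHS]eq_fun do rewrite mulrC.
    by rewrite (EcZ _ (mFH a b)) mulrC mxE.
  + move=> b; apply: cmomM; [exact: cmomS sS (mFH a b)|exact: cmom_cst].
  + move=> b; apply: cmomM; [exact: cmomS sS (mFH a b)|exact: cmomS sT (mV b a)].
- move=> a; apply: cmom_sum => b.
  apply: cmomM; [exact: cmomS sS (mFH a b)|exact: cmom_cst].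
- move=> a; apply: cmom_sum => b.
  apply: cmomM; [exact: cmomS sS (mFH a b)|exact: cmomS sT (mV b a)].
Qed.

(** * Second moments of a sum of random gains applied to white vectors *)

Section White.
Variables (L : finType) (dim : L -> nat) (n : nat).
Variables (F : forall t, Omega -> 'M[C]_(n, dim t)) (u : forall t, Omega -> 'cV[C]_(dim t)).
Variable v : L -> C.
Hypothesis mF : forall t, mmom (cyl X S) (F t).
Hypothesis mu : forall t, mmom (cyl X T) (u t).
Hypothesis u_orth : forall s t, s != t -> Emx P (fun w => u s w *m hadj (u t w)) = 0.
Hypothesis u_var : forall t, Emx P (fun w => u t w *m hadj (u t w)) = (v t)%:M.

Let y w := \sum_t F t w *m u t w.

Let mFT t : mmom (cyl X [set: I]%SET) (F t).
Proof. exact: mmomS (@cyl_subT S) (@mF t). Qed.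

Let muT t : mmom (cyl X [set: I]%SET) (u t).
Proof. exact: mmomS (@cyl_subT T) (@mu t). Qed.

Let mV s t : mmom (cyl X T) (fun w => u s w *m hadj (u t w)).
Proof. by apply: mmomM => //; exact: mmom_hadj. Qed.

Lemma mmom_white_sum : mmom (cyl X [set: I]%SET) y.
Proof. by apply: mmom_sum => t; exact: mmomM. Qed.

Lemma Emx_const0 m q l (A : Omega -> 'M[C]_(m, q)) (B : Omega -> 'M[C]_(q, l)) :
  (forall w, A w *m B w = 0) -> Emx P (fun w => A w *m B w) = 0.
Proof.
move=> H; apply/matrixP => i j; rewrite !mxE.
by under eq_fun do rewrite H mxE; rewrite Ec_cst.
Qed.

(** Conditioning on the gains in effect: [Emx_sandwich] averages the sources inside the double sum,
    and orthogonality leaves the diagonal. *)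
Lemma Emx_white_self :
  Emx P (fun w => y w *m hadj (y w)) =
  \sum_t v t *: Emx P (fun w => F t w *m hadj (F t w)).
Proof.
have yE w : y w *m hadj (y w) =
    \sum_s \sum_t F s w *m (u s w *m hadj (u t w)) *m hadj (F t w).
  rewrite /y hadj_sum mulmx_suml; apply: eq_bigr => s _.
  by rewrite mulmx_sumr; apply: eq_bigr => t _; rewrite hadjM !mulmxA.
under eq_fun do rewrite yE.
have m1 s t : mmom (cyl X [set: I]%SET)
    (fun w => F s w *m (u s w *m hadj (u t w)) *m hadj (F t w)).
  apply: mmomM; last exact: mmom_hadj.
  by apply: mmomM => //; apply: mmomM => //; exact: mmom_hadj.
rewrite (Emx_sum (G := cyl X [set: I]%SET)); last by move=> s; exact: mmom_sum.
apply: eq_bigr => s _; rewrite (Emx_sum (G := cyl X [set: I]%SET))//.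
rewrite (bigD1 s)//= big1 ?addr0 => [|t ts].
  rewrite Emx_sandwich//; last exact: mmom_hadj.
  rewrite u_var -(EmxZ (G := cyl X [set: I]%SET)); last by apply: mmomM => //; exact: mmom_hadj.
  by congr Emx; apply/funext => w; rewrite mul_mx_scalar -scalemxAl.
rewrite Emx_sandwich//; last exact: mmom_hadj.
rewrite u_orth 1?eq_sym//; apply: Emx_const0 => w.
by rewrite mulmx0 mul0mx.
Qed.

Lemma Emx_white_cross s :
  Emx P (fun w => y w *m hadj (u s w)) = v s *: Emx P (F s).
Proof.
(* The trivial right factor gives each term the shape of [Emx_sandwich]. *)
have yE w : y w *m hadj (u s w) =
    \sum_t F t w *m (u t w *m hadj (u s w)) *m 1%:M.
  by rewrite /y mulmx_suml; apply: eq_bigr => t _; rewrite mulmx1 mulmxA.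
under eq_fun do rewrite yE.
have m1 t : mmom (cyl X [set: I]%SET) (fun w => F t w *m (u t w *m hadj (u s w)) *m 1%:M).
  apply: mmomM; last exact: mmom_cst.
  by apply: mmomM => //; apply: mmomM => //; exact: mmom_hadj.
rewrite (Emx_sum (G := cyl X [set: I]%SET))//.
rewrite (bigD1 s)//= big1 ?addr0 => [|t ts].
  rewrite Emx_sandwich//; last exact: mmom_cst.
  rewrite u_var -(EmxZ (G := cyl X [set: I]%SET))//.
  by congr Emx; apply/funext => w; rewrite mulmx1 mul_mx_scalar.
rewrite Emx_sandwich//; last exact: mmom_cst.
by rewrite u_orth//; apply: Emx_const0 => w; rewrite mulmx0 mul0mx.
Qed.

End White.
End Disjoint.
End Independence.
End ComplexMoments.

(** * From linear estimation to mutual information *)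


Section Realify.
Context {R : realType}.
Local Notation C := R[i].

(* As in [cvec_coords], the boolean [true] selects the imaginary part. *)
Definition ccoord n (v : 'cV[C]_n) (s : 'I_n * bool) : R :=
  if s.2 then complex.Im (v s.1 0) else complex.Re (v s.1 0).

(** The real matrix of [N] acting on the coordinates [ccoord]: each entry becomes the 2 by 2 block
    of multiplication by it. *)
Definition realify m n (N : 'M[C]_(m, n)) (s : 'I_m * bool) (t : 'I_n * bool) : R :=
  let z := N s.1 t.1 in
  if s.2 then (if t.2 then complex.Re z else complex.Im z)
  else (if t.2 then - complex.Im z else complex.Re z).

Lemma ccoordD n (u v : 'cV[C]_n) s : ccoord (u + v) s = ccoord u s + ccoord v s.
Proof. by rewrite /ccoord mxE complexReD complexImD; case: s.2. Qed.

Lemma ccoord_mul m n (N : 'M[C]_(m, n)) v s :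
  ccoord (N *m v) s = \sum_t realify N s t * ccoord v t.
Proof.
rewrite -(pair_bigA _ (fun j c => realify N s (j, c) * ccoord v (j, c)))/=.
rewrite /ccoord mxE Re_sum Im_sum /realify /=.
case: s => i [] /=; apply: eq_bigr => j _; rewrite big_bool/= ?complexReM ?complexImM; ring.
Qed.

Lemma realify_eq0 m n (N : 'M[C]_(m, n)) s t : N s.1 t.1 = 0 -> realify N s t = 0.
Proof. by rewrite /realify => ->; case: s.2; case: t.2; rewrite /= ?oppr0. Qed.

End Realify.

Section LinearEstimation.
Context {R : realType} {d : measure_display} {Omega : measurableType d}.
Variable P : probability Omega R.
Local Notation C := R[i].
Variable G : set (set Omega).

Lemma rmom_ccoord n (U : Omega -> 'cV[C]_n) s : mmom P G U ->
  rmom P G (fun w => ccoord (U w) s).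
Proof. by move=> mU; rewrite /ccoord; have [? ?] := mU s.1 0; case: s.2. Qed.

Lemma Emx_residual m n (U : Omega -> 'cV[C]_m) (V : Omega -> 'cV[C]_n)
    (B : 'M[C]_(m, n)) : mmom P G U -> mmom P G V ->
  Emx P (fun w => (U w - B *m V w) *m hadj (U w - B *m V w)) =
  Emx P (fun w => U w *m hadj (U w))
  - B *m hadj (Emx P (fun w => U w *m hadj (V w)))
  - Emx P (fun w => U w *m hadj (V w)) *m hadj B
  + B *m Emx P (fun w => V w *m hadj (V w)) *m hadj B.
Proof.
move=> mU mV.
have mUU : mmom P G (fun w => U w *m hadj (U w)) by apply: mmomM (mmom_hadj _).
have mUV : mmom P G (fun w => U w *m hadj (V w)) by apply: mmomM (mmom_hadj _).
have mVU : mmom P G (fun w => V w *m hadj (U w)) by apply: mmomM (mmom_hadj _).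
have mVV : mmom P G (fun w => V w *m hadj (V w)) by apply: mmomM (mmom_hadj _).
have mc k l (A : 'M[C]_(k, l)) : mmom P G (fun=> A) by exact: mmom_cst.
have -> : Emx P (fun w => (U w - B *m V w) *m hadj (U w - B *m V w)) =
    Emx P (fun w => U w *m hadj (U w) + ((- B) *m (V w *m hadj (U w)) +
      ((U w *m hadj (V w)) *m (- hadj B) + B *m ((V w *m hadj (V w)) *m hadj B)))).
  congr Emx; apply/funext => w; rewrite hadjB hadjM mulmxBl !mulmxBr !mulmxA.
  rewrite !mulNmx !mulmxN opprB -!addrA; congr (_ + _).
  by rewrite [RHS]addrCA; congr (_ + _); exact: addrC.
have m1 : mmom P G (fun w => (- B) *m (V w *m hadj (U w))) by exact: mmomM.
have m2 : mmom P G (fun w => (U w *m hadj (V w)) *m (- hadj B)) by exact: mmomM.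
have m3' : mmom P G (fun w => (V w *m hadj (V w)) *m hadj B) by exact: mmomM.
have m3 : mmom P G (fun w => B *m ((V w *m hadj (V w)) *m hadj B)) by exact: mmomM.
have m4 := mmomD m2 m3.
rewrite (EmxD mUU (mmomD m1 m4)) (EmxD m1 m4) (EmxD m2 m3).
rewrite (EmxMl _ mVU) (EmxMr _ mUV) (EmxMl _ m3') (EmxMr _ mVV).
rewrite -(Emx_hadj mUV).
have -> : Emx P (fun w => hadj (U w *m hadj (V w))) = Emx P (fun w => V w *m hadj (U w)).
  by congr Emx; apply/funext => w; rewrite hadjM hadjK.
by rewrite mulNmx mulmxN mulmxA !addrA.
Qed.

Lemma Rintegral_ccoord_sqr n (U : Omega -> 'cV[C]_n) i : mmom P G U ->
  \int[P]_w (ccoord (U w) (i, true) ^+ 2) + \int[P]_w (ccoord (U w) (i, false) ^+ 2) =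
  complex.Re (Emx P (fun w => U w *m hadj (U w)) i i).
Proof.
move=> mU; have m1 := rmomX 2 (rmom_ccoord (i, true) mU).
have m2 := rmomX 2 (rmom_ccoord (i, false) mU).
rewrite -(rmom_RintegralD m1 m2) mxE /Ec/=; apply: eq_Rintegral => w _.
rewrite mxE big_ord1 hadjE complexReM complexReJ complexImJ /ccoord/=; ring.
Qed.

Lemma ln_prodr (I : finType) (D : I -> R) : (forall i, 0 < D i) ->
  ln (\prod_i D i) = \sum_i ln (D i).
Proof.
move=> D0; rewrite -[RHS]expRK expR_sum; congr ln; apply: eq_bigr => i _.
by rewrite lnK// posrE.
Qed.

Section MutualInfoMMSE.
Variables (n : nat) (X Yobs : Omega -> 'cV[C]_n) (s : C) (E Psi : 'M[C]_n).
(** Moments are stated for the scaled [Y], the conclusion for [Yobs]; the scale enters the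
    coefficients [b] of the test function, so invariance of mutual information under scaling is not
    invoked. *)
Let Y w := s *: Yobs w.
Hypothesis mX : mmom P G X.
Hypothesis mYobs : mmom P G Yobs.
Hypothesis indX : mutually_independent P (cvec_coords X).
Hypothesis lawX : forall ib B, measurable B ->
  P (cvec_coords X ib @^-1` B) = normal_prob 0 (Num.sqrt (1 / 2)) B.
Hypothesis EXX : Emx P (fun w => X w *m hadj (X w)) = 1%:M.
Hypothesis EYX : Emx P (fun w => Y w *m hadj (X w)) = E.
Hypothesis EYY : Emx P (fun w => Y w *m hadj (Y w)) = Psi + E *m hadj E.
Hypothesis uPsi : Psi \in unitmx.

Let mY : mmom P G Y.
Proof. exact: mmomZ. Qed.

Let mYY : mmom P G (fun w => Y w *m hadj (Y w)).
Proof. exact: mmomM (mmom_hadj _). Qed.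

Let mYX : mmom P G (fun w => Y w *m hadj (X w)).
Proof. exact: mmomM (mmom_hadj _). Qed.

Let hPsi : hadj Psi = Psi.
Proof.
have -> : Psi = Emx P (fun w => Y w *m hadj (Y w)) - E *m hadj E by rewrite EYY addrK.
rewrite hadjB hadjM hadjK -(Emx_hadj mYY); congr (_ - _).
by congr Emx; apply/funext => w; rewrite hadjM hadjK.
Qed.

(** [Psi] is the covariance of the residual [Y - E X]. *)
Let psdPsi v : 0 <= qform Psi v.
Proof.
have mz : mmom P G (fun w => Y w - E *m X w).
  apply: mmomD => //; under eq_fun do rewrite -mulNmx.
  by apply: mmomM => //; exact: mmom_cst.
have := qform_Emx_ge0 v mz; rewrite Emx_residual// EXX EYX EYY mulmx1.
by rewrite addrK subrK.
Qed.

Let Q := snr_mx E Psi.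
Let A := mmse_mx E Psi.
Let err w := X w - A *m Y w.

Let merr : mmom P G err.
Proof.
apply: mmomD => //; under eq_fun do rewrite -mulNmx.
by apply: mmomM => //; exact: mmom_cst.
Qed.

Let Eerr : Emx P (fun w => err w *m hadj (err w)) = invmx Q.
Proof.
rewrite Emx_residual// EXX EYY.
have -> : Emx P (fun w => X w *m hadj (Y w)) = hadj E.
  rewrite -EYX -(Emx_hadj mYX); congr Emx; apply/funext => w.
  by rewrite hadjM hadjK.
by rewrite hadjK mmse_error.
Qed.

Theorem mutual_info_ge_mmse :
  ((ln (complex.Re (\det Q)) / ln 2)%:E <=
   mutual_info P (cvec_coords X) (cvec_coords Yobs))%E.
Proof.
have [L [D [trL dL pD QE dQ]]] :=
  LDL_decomposition (hadj_snr_mx E uPsi hPsi) (posdef_snr_mx E uPsi hPsi psdPsi).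
(* Chosen so that [X + lin] has the real coordinates of [L *m (X - A *m Y)], the error made
   uncorrelated by [L]. *)
pose a := realify (L - 1%:M).
pose b := realify (- (s *: (L *m A))).
(* The order is reversed because row [i] of [L] involves indices at least [i]. Both parts of one
   entry share a rank, which is allowed since [L - 1%:M] has zero diagonal. *)
pose r (t : 'I_n * bool) := (n - t.1)%N.
pose Dt (t : 'I_n * bool) := D 0 t.1.
have a_r t u : a t u != 0 -> (r u < r t)%N.
  apply: contra_neqT; rewrite -leqNgt /r => tu.
  apply: realify_eq0; rewrite !mxE; case: (ltngtP u.1 t.1) => ut.
  - by rewrite trL// -val_eqE/= gtn_eqF// subr0.
  - by move: tu; rewrite leqNgt ltn_sub2l.
  - by rewrite (val_inj ut : u.1 = t.1) dL eqxx subrr.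
have := @mutual_info_ge_qtest _ _ _ P _ _ (cvec_coords X) (cvec_coords Yobs) G
  r a b Dt (fun i => rmom_ccoord i mX) (fun j => rmom_ccoord j mYobs) indX lawX a_r
  (fun i => pD i.1).
congr (_ <= _)%E; congr (_ / _)%:E.
pose LE w := L *m err w.
have mLE : mmom P G LE by apply: mmomM => //; exact: mmom_cst.
have linE w t : cvec_coords X t w + lin a b (cvec_coords X ^~ w) (cvec_coords Yobs ^~ w) t =
    ccoord (LE w) t.
  have -> : LE w = X w + ((L - 1%:M) *m X w + (- (s *: (L *m A))) *m Yobs w).
    rewrite /LE /err mulmxBr mulmxBl mul1mx addrA subrKC; congr (_ + _).
    by rewrite mulNmx /Y -scalemxAr -scalemxAr -scalemxAl mulmxA.
  by rewrite 2!ccoordD !ccoord_mul.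
have mLs t := rmomX 2 (rmom_ccoord t mLE).
have mXs t := rmomX 2 (rmom_ccoord t mX).
transitivity (\sum_t (\int[P]_w (ccoord (X w) t ^+ 2) +
    (- Dt t * \int[P]_w (ccoord (LE w) t ^+ 2) + ln (Dt t) / 2))).
  have mg t : rmom P G (fun w => ccoord (X w) t ^+ 2 +
      (- Dt t * ccoord (LE w) t ^+ 2 + ln (Dt t) / 2)).
    by apply: rmomD => //; apply: rmomD; [exact: rmomZ|exact: rmom_cst].
  transitivity (\int[P]_w \sum_t (ccoord (X w) t ^+ 2 +
      (- Dt t * ccoord (LE w) t ^+ 2 + ln (Dt t) / 2))).
    apply: eq_Rintegral => w _; apply: eq_bigr => t _.
    by rewrite /gtest linE addrA mulNr.
  rewrite (rmom_Rintegral_sum _ mg); apply: eq_bigr => t _.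
  rewrite (rmom_RintegralD (mXs t)); last by apply: rmomD; [exact: rmomZ|exact: rmom_cst].
  rewrite (rmom_RintegralD (rmomZ _ (mLs t)) (rmom_cst _ _ _)).
  by rewrite (rmom_RintegralZ _ (mLs t)) Rintegral_probability_cst.
have uQ : Q \in unitmx := unitmx_snr_mx E uPsi hPsi psdPsi.
have uL : L \in unitmx.
  by move: uQ; rewrite /Q QE unitmx_mul => /andP[].
(* The covariance of [LE] is [L *m invmx Q *m hadj L], which the factorisation of [Q] makes the
   inverse of the diagonal factor. *)
have ELE : Emx P (fun w => LE w *m hadj (LE w)) *m
    diag_mx (map_mx (real_complex R) D) = 1%:M.
  have -> : Emx P (fun w => LE w *m hadj (LE w)) = L *m invmx Q *m hadj L.
    rewrite -Eerr; have mee : mmom P G (fun w => err w *m hadj (err w)).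
      exact: mmomM (mmom_hadj _).
    have mLee : mmom P G (fun w => L *m (err w *m hadj (err w))).
      by apply: mmomM => //; exact: mmom_cst.
    rewrite -(EmxMl _ mee) -(EmxMr _ mLee).
    by congr Emx; apply/funext => w; rewrite /LE hadjM !mulmxA.
  apply: (can_inj (mulmxK uL)); rewrite mul1mx -!mulmxA (mulmxA (hadj L)) -QE.
  by rewrite mulVmx// mulmx1.
(* Pairing real and imaginary parts of entry [i]: the second moments of [X] add up to 1, and the two
   halves of the logarithm to [ln (D 0 i)]. By [ELE] the first two terms then cancel. *)
transitivity (\sum_i (1 - D 0 i * complex.Re (Emx P (fun w => LE w *m hadj (LE w)) i i)
    + ln (D 0 i))).
  rewrite -(pair_bigA _ (fun i c => \int[P]_w (ccoord (X w) (i, c) ^+ 2) +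
    (- Dt (i, c) * \int[P]_w (ccoord (LE w) (i, c) ^+ 2) + ln (Dt (i, c)) / 2)))/=.
  apply: eq_bigr => i _; rewrite big_bool/= /Dt/=.
  rewrite -(Rintegral_ccoord_sqr i mLE).
  have := Rintegral_ccoord_sqr i mX; rewrite EXX mxE eqxx/=.
  by rewrite mulrDr !mulNr; lra.
rewrite dQ/= ln_prodr//; apply: eq_bigr => i _.
have /matrixP/(_ i i) := ELE; rewrite mul_mx_diag !mxE eqxx.
move=> /(congr1 (@complex.Re R)); rewrite complexReM/= mulr0 subr0 mulrC => ->.
by rewrite subrr add0r.
Qed.

End MutualInfoMMSE.
End LinearEstimation.

Section Subfamily.
Context {R : realType} {d : measure_display} {Omega : measurableType d}.
Variable P : probability Omega R.

Lemma mutually_independent_inj (I J : finType) (X : I -> Omega -> R) (h : J -> I) :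
  injective h -> mutually_independent P X ->
  mutually_independent P (fun j => X (h j)).
Proof.
move=> hi indX S B mB.
(* The Borel sets are transported along [h]; off its image [setT] is a mere default. *)
pose B' i := if [pick j | h j == i] is Some j then B j else setT.
have B'h j : B' (h j) = B j.
  rewrite /B'; case: pickP => [k /eqP/hi->//|/(_ j)]; by rewrite eqxx.
have mB' i : measurable (B' i) by rewrite /B'; case: pickP.
have := indX [set h j | j in S]%SET B' mB'.
rewrite big_imset/=; last by move=> ? ? _ _; exact: hi.
under eq_bigr do rewrite B'h; move=> <-; congr (P _).
apply/seteqP; split => w /= H.
  by move=> _ /imsetP[j jS ->] /=; rewrite B'h; exact: H.
by move=> j jS /=; have := H (h j) (imset_f _ jS); rewrite /= B'h.
Qed.

End Subfamily.

(** * Second-order statistics of the uplink with maximum ratio combining *)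

Section Model.
Context {R : realType} {d : measure_display} {Omega : measurableType d}.
Variable P : probability Omega R.
Local Notation C := R[i].
Variables (M K Nr Ns nr ns : nat).
Variables (Ur : 'I_M -> 'M[C]_(Nr, nr)) (Us : 'I_K -> 'M[C]_(Ns, ns)).
Variables (Sg : 'I_M -> 'I_K -> 'M[R]_(nr, ns)).
Variables (W : 'I_M -> 'I_K -> Omega -> 'M[C]_(nr, ns)).
Variables (x : 'I_K -> Omega -> 'cV[C]_Ns) (nz : 'I_M -> Omega -> 'cV[C]_Nr).
Variables (p sigma2 : R).
Hypothesis M0 : (0 < M)%N.
Hypothesis p0 : 0 < p.
Hypothesis sigma0 : 0 < sigma2.
Local Notation idx := (Idx M K Nr Ns nr ns).
Local Notation coords := (all_coords W x nz).
Hypothesis mcoords : forall ib, measurable_fun setT (coords ib).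
Hypothesis icoords : mutually_independent P coords.
Hypothesis lcoords : forall (ib : idx * bool) (B : set R), measurable B ->
  P (coords ib @^-1` B) = normal_prob 0 (Num.sqrt (elem_var sigma2 ib.1 / 2)) B.
Variable k : 'I_K.

(** Splits the elementary coordinates into those of the channels, which determine the gains, and
    those of data and noise, which determine the sources. *)
Definition channel_idx : {set idx * bool} :=
  [set ib | if ib.1 is inl (inl _) then true else false]%SET.
Local Notation SW := channel_idx.
Local Notation SN := (~: channel_idx)%SET.

Let var_gt0 (i : idx) : 0 < elem_var sigma2 i / 2.
Proof. by case: i => [[i|i]|i]; rewrite divr_gt0. Qed.

Let sd_neq0 (i : idx) : Num.sqrt (elem_var sigma2 i / 2) != 0.
Proof. by rewrite gt_eqF// sqrtr_gt0 var_gt0. Qed.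

Let rmom_coords (S : {set idx * bool}) ib : ib \in S -> rmom P (cyl coords S) (coords ib).
Proof.
move=> iS; apply: rmom_cyl => // n.
exact: gaussian_integrable_expn (sd_neq0 ib.1) (mcoords ib) (@lcoords ib) n.
Qed.

Let cmom_scalar (S : {set idx * bool}) i : (i, true) \in S -> (i, false) \in S ->
  cmom P (cyl coords S) (scalar_of W x nz i).
Proof. by move=> iT iF; split; [exact: rmom_coords iF|exact: rmom_coords iT]. Qed.

Let mmom_x l : mmom P (cyl coords SN) (x l).
Proof.
move=> i j; rewrite ord1.
by apply: (@cmom_scalar SN (inl (inr (l, i)))); rewrite !inE.
Qed.

Let mmom_nz m : mmom P (cyl coords SN) (nz m).
Proof.
move=> i j; rewrite ord1.
by apply: (@cmom_scalar SN (inr (m, i))); rewrite !inE.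
Qed.

Local Notation H := (chan W Ur Us Sg).

Let mmom_H m l : mmom P (cyl coords SW) (H m l).
Proof.
apply: mmomM; last exact: mmom_cst.
apply: mmomM; first exact: mmom_cst.
move=> i j; under eq_fun do rewrite mxE.
apply: cmomM; first exact: cmom_cst.
by apply: (@cmom_scalar SW (inl (inl (m, l, i, j)))); rewrite !inE.
Qed.

Let disjSW : disjoint (mem SW) (mem SN).
Proof. by rewrite -setI_eq0 finset.setICr. Qed.

Let E_coords ib jb : \int[P]_w (coords ib w * coords jb w) =
  if ib == jb then elem_var sigma2 ib.1 / 2 else 0.
Proof.
case: eqVneq => [<-|ij].
  rewrite (gaussian_second_moment (sd_neq0 ib.1) (mcoords ib) (@lcoords ib)).
  by rewrite sqr_sqrtr// ltW.
have dij : disjoint (mem [set ib]%SET) (mem [set jb]%SET).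
  by rewrite disjoints1 inE.
rewrite (expectation_mul_cyl mcoords icoords dij); last 2 first.
- by apply: rmom_coords; rewrite inE.
- by apply: rmom_coords; rewrite inE.
by rewrite (gaussian_mean (sd_neq0 ib.1) (mcoords ib) (@lcoords ib)) mul0r.
Qed.

Let Ec_scalar i j : Ec P (fun w => scalar_of W x nz i w * (scalar_of W x nz j w)^*) =
  if i == j then (elem_var sigma2 i)%:C%C else 0.
Proof.
have rT ib : rmom P (cyl coords [set: idx * bool]%SET) (coords ib).
  by apply: rmom_coords; rewrite inE.
have rM ib jb := rmomM (rT ib) (rT jb).
rewrite /Ec.
have -> : \int[P]_w complex.Re (scalar_of W x nz i w * (scalar_of W x nz j w)^*) =
    \int[P]_w (coords (i, false) w * coords (j, false) w +
      coords (i, true) w * coords (j, true) w).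
  by apply: eq_Rintegral => w _; rewrite complexReM complexReJ complexImJ mulrN opprK.
have -> : \int[P]_w complex.Im (scalar_of W x nz i w * (scalar_of W x nz j w)^*) =
    \int[P]_w (-1 * (coords (i, false) w * coords (j, true) w) +
      coords (i, true) w * coords (j, false) w).
  by apply: eq_Rintegral => w _; rewrite complexImM complexReJ complexImJ mulrN mulN1r.
rewrite (rmom_RintegralD (rM _ _) (rM _ _)) (rmom_RintegralD (rmomZ _ (rM _ _)) (rM _ _)).
rewrite (rmom_RintegralZ _ (rM _ _)) !E_coords !xpair_eqE !andbF !andbT mulr0 addr0.
by case: eqP => _ /=; [rewrite -splitr|rewrite addr0].
Qed.

(* The received signal is linear in the independent white vectors [x l] and
   [nz m], with gains depending on the channels only. *)
Definition src := ('I_K + 'I_M)%type.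
Definition src_dim (t : src) : nat := match t with inl _ => Ns | inr _ => Nr end.

Definition src_vec (t : src) : Omega -> 'cV[C]_(src_dim t) :=
  match t return Omega -> 'cV[C]_(src_dim t) with
  | inl l => x l | inr m => nz m end.

Definition src_idx (t : src) : 'I_(src_dim t) -> idx :=
  match t return 'I_(src_dim t) -> idx with
  | inl l => fun i => inl (inr (l, i)) | inr m => fun i => inr (m, i) end.

Definition src_gain (t : src) : Omega -> 'M[C]_(Ns, src_dim t) :=
  match t return Omega -> 'M[C]_(Ns, src_dim t) with
  | inl l => fun w => (Num.sqrt p)%:C%C *: \sum_m hadj (H m k w) *m H m l w
  | inr m => fun w => hadj (H m k w) end.

Definition src_var (t : src) : C :=
  match t with inl _ => 1 | inr _ => sigma2%:C%C end.

Let src_vecE t w i j : src_vec t w i j = scalar_of W x nz (src_idx i) w.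
Proof. by case: t i => t i; rewrite ord1. Qed.

Let mmom_gain t : mmom P (cyl coords SW) (src_gain t).
Proof.
case: t => [l|m] /=; last exact: mmom_hadj.
by apply: mmomZ; apply: mmom_sum => m; apply: mmomM => //; exact: mmom_hadj.
Qed.

Let mmom_src t : mmom P (cyl coords SN) (src_vec t).
Proof. by case: t => [l|m]; [exact: mmom_x|exact: mmom_nz]. Qed.

Let Emx_src s t i j : Emx P (fun w => src_vec s w *m hadj (src_vec t w)) i j =
  if src_idx i == src_idx j then (elem_var sigma2 (src_idx i))%:C%C else 0.
Proof.
rewrite mxE -Ec_scalar; congr Ec; apply/funext => w.
by rewrite mxE big_ord1 hadjE !src_vecE.
Qed.

Let src_orth s t : s != t -> Emx P (fun w => src_vec s w *m hadj (src_vec t w)) = 0.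
Proof.
move=> st; apply/matrixP => i j; rewrite Emx_src mxE; case: eqP => // ij.
move: st; case: s t i j ij => [l|m] [l'|m'] i j //=.
  by move=> [->]; rewrite eqxx.
by move=> [->]; rewrite eqxx.
Qed.

Let src_idx_inj t : injective (@src_idx t).
Proof. by case: t => t i j /= []. Qed.

Let src_white t : Emx P (fun w => src_vec t w *m hadj (src_vec t w)) = (src_var t)%:M.
Proof.
apply/matrixP => i j; rewrite Emx_src mxE (inj_eq (@src_idx_inj t)).
case: eqP => // _; rewrite mulr1n.
by clear j; case: t i => t i.
Qed.

(** The factor undoes the average over base stations, so that the moments of [Y] are exactly those
    in [Ek1] and [Psik1]. *)
Let Y w : 'cV[C]_Ns := M%:R *: xhat W x nz Ur Us Sg p k w.

Let YE w : Y w = \sum_t src_gain t w *m src_vec t w.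
Proof.
rewrite /Y /xhat scalerA divff ?scale1r; last by rewrite pnatr_eq0 -lt0n.
rewrite big_sumType/= /xcheck /rx /V_MR.
under eq_bigr do rewrite mulmxDr; rewrite big_split/=; congr (_ + _).
under eq_bigr do rewrite -scalemxAr mulmx_sumr; rewrite -scaler_sumr exchange_big/=.
rewrite scaler_sumr; apply: eq_bigr => l _; rewrite -scalemxAl mulmx_suml.
by congr (_ *: _); apply: eq_bigr => m _; rewrite mulmxA.
Qed.

Let mT : cyl coords SW `<=` cyl coords [set: idx * bool]%SET.
Proof. exact: cyl_subT. Qed.

Let mHT m l : mmom P (cyl coords [set: idx * bool]%SET) (H m l).
Proof. exact: mmomS mT (@mmom_H m l). Qed.

Let mHhT m l : mmom P (cyl coords [set: idx * bool]%SET) (fun w => hadj (H m l w)).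
Proof. exact: mmom_hadj. Qed.

Let mHH m l : mmom P (cyl coords [set: idx * bool]%SET)
  (fun w => hadj (H m k w) *m H m l w).
Proof. exact: mmomM. Qed.

Let mY : mmom P (cyl coords [set: idx * bool]%SET) Y.
Proof.
have := mmom_white_sum mmom_gain mmom_src.
by congr mmom; apply/funext => w; rewrite YE.
Qed.

Let E_YX : Emx P (fun w => Y w *m hadj (x k w)) = Ek1 W Ur Us Sg p P k.
Proof.
have := @Emx_white_cross _ _ _ P _ coords mcoords icoords SW SN disjSW _ _ _
  src_gain src_vec src_var mmom_gain mmom_src src_orth src_white (inl k).
rewrite /= scale1r (EmxZ _ (G := cyl coords [set: idx * bool]%SET)); last exact: mmom_sum.
rewrite (Emx_sum _ (G := cyl coords [set: idx * bool]%SET))// => E0.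
transitivity ((Num.sqrt p)%:C%C *:
    \sum_m Emx P (fun w => hadj (H m k w) *m H m k w)) => //.
by rewrite -E0; congr Emx; apply/funext => w; rewrite YE.
Qed.

(** Each data source [l] contributes [p] times the double sum of [Tmat], the noise contributes the
    terms in [Zmat], and the product subtracted in [Psik1] is restored. *)
Let E_YY : Emx P (fun w => Y w *m hadj (Y w)) =
  Psik1 W Ur Us Sg p sigma2 P k + Ek1 W Ur Us Sg p P k *m hadj (Ek1 W Ur Us Sg p P k).
Proof.
have := @Emx_white_self _ _ _ P _ coords mcoords icoords SW SN disjSW _ _ _
  src_gain src_vec src_var mmom_gain mmom_src src_orth src_white.
under eq_fun do rewrite -YE; move=> ->.
rewrite /Psik1 addrAC subrK big_sumType/=; congr (_ + _); last first.
  have HK m : Emx P (fun w => hadj (H m k w) *m hadj (hadj (H m k w))) =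
      Zmat W Ur Us Sg P m k.
    by congr Emx; apply/funext => w; rewrite hadjK.
  by under eq_bigr do rewrite HK; rewrite -scaler_sumr.
rewrite scaler_sumr; apply: eq_bigr => l _; rewrite scale1r.
pose T m m' w := hadj (H m k w) *m H m l w *m hadj (H m' l w) *m H m' k w.
have mTT m m' : mmom P (cyl coords [set: idx * bool]%SET) (T m m').
  by apply: mmomM => //; apply: mmomM.
have -> : Emx P (fun w =>
    ((Num.sqrt p)%:C%C *: \sum_m hadj (H m k w) *m H m l w) *m
    hadj ((Num.sqrt p)%:C%C *: \sum_m hadj (H m k w) *m H m l w)) =
    Emx P (fun w => p%:C%C *: \sum_m \sum_m' T m m' w).
  congr Emx; apply/funext => w; rewrite hadjZ -scalemxAl -scalemxAr scalerA.
  congr (_ *: _).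
    by rewrite conjCE/= oppr0 -rmorphM/= -expr2 sqr_sqrtr// ltW.
  rewrite hadj_sum mulmx_suml; apply: eq_bigr => m _.
  by rewrite mulmx_sumr; apply: eq_bigr => m' _; rewrite /T hadjM hadjK !mulmxA.
rewrite (EmxZ _ (G := cyl coords [set: idx * bool]%SET)); last first.
  by apply: mmom_sum => m; exact: mmom_sum.
rewrite (Emx_sum _ (G := cyl coords [set: idx * bool]%SET)); last first.
  by move=> m; exact: mmom_sum.
congr (_ *: _); apply: eq_bigr => m _.
by rewrite (Emx_sum _ (G := cyl coords [set: idx * bool]%SET)).
Qed.

Lemma mutual_info_ge_SE1 : Psik1 W Ur Us Sg p sigma2 P k \in unitmx ->
  ((SE1 W Ur Us Sg p sigma2 P k)%:E <=
   mutual_info P (cvec_coords (x k)) (cvec_coords (xhat W x nz Ur Us Sg p k)))%E.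
Proof.
move=> uPsi.
(* Embeds the coordinates of [x k] among the elementary ones, whence their independence and law. *)
pose h (s : 'I_Ns * bool) : idx * bool := (inl (inr (k, s.1)), s.2).
have hi : injective h by move=> [i b] [j c] [-> ->].
apply: (@mutual_info_ge_mmse _ _ _ P (cyl coords [set: idx * bool]%SET) _ (x k)
  (xhat W x nz Ur Us Sg p k) M%:R _ _ _ _ _ _ _ E_YX E_YY uPsi).
- by apply: mmomS (@mmom_x k); exact: cyl_subT.
- have := mmomZ (M%:R^-1) mY; congr mmom; apply/funext => w.
  by rewrite /Y scalerA mulVf ?scale1r// pnatr_eq0 -lt0n.
- exact: (mutually_independent_inj hi icoords).
- by move=> ib B mB; exact: (lcoords (h ib) mB).
- exact: (@src_white (inl k)).
Qed.

End Model.

Theorem theorem1 (R : realType) (d : measure_display) (Omega : measurableType d)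
  (P : probability Omega R) (M K Nr Ns nr ns : nat)
  (Ur : 'I_M -> 'M[R[i]]_(Nr, nr)) (Us : 'I_K -> 'M[R[i]]_(Ns, ns))
  (Sg : 'I_M -> 'I_K -> 'M[R]_(nr, ns))
  (W : 'I_M -> 'I_K -> Omega -> 'M[R[i]]_(nr, ns))
  (x : 'I_K -> Omega -> 'cV[R[i]]_Ns)
  (nz : 'I_M -> Omega -> 'cV[R[i]]_Nr)
  (p sigma2 : R) :
  (0 < M)%N -> 0 < p -> 0 < sigma2 ->
  (* all real/imaginary parts of the entries of the W^(mk), x_k, n_m are
     random variables ... *)
  (forall ib, measurable_fun setT (all_coords W x nz ib)) ->
  (* ... which are mutually independent ... *)
  mutually_independent P (all_coords W x nz) ->
  (* ... each entry being CN(0, v): real and imaginary parts N(0, v/2) *)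
  (forall (ib : Idx M K Nr Ns nr ns * bool) (B : set R), measurable B ->
     P (all_coords W x nz ib @^-1` B) =
     normal_prob 0 (Num.sqrt (elem_var sigma2 ib.1 / 2)) B) ->
  forall k : 'I_K,
  Psik1 W Ur Us Sg p sigma2 P k \in unitmx ->
  ((SE1 W Ur Us Sg p sigma2 P k)%:E <=
     mutual_info P (cvec_coords (x k)) (cvec_coords (xhat W x nz Ur Us Sg p k)))%E.
Proof.
move=> M0 p0 sigma0 mC iC lC k uPsi.
exact: (mutual_info_ge_SE1 M0 p0 sigma0 mC iC lC uPsi).
Qed.
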